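(* Let $\zeta_3$ be a primitive third root of unity. Then $$\widetilde{\mathrm{PP}}(\zeta_3,q)=A_0(q^3)+qA_1(q^3)+q^2A_2(q^3),$$ where \begin{align*} A_0(q) &= \frac{(q^{9};q^{9})_\infty\,[q^3;q^{9}]_\infty}{[q;q^{9}]_\infty^2\,[q^{4};q^{9}]_\infty} -\frac{1}{(q^{9};q^{9})_\infty[q^2;q^{9}]_\infty}\bigl(\Sigma(1,-14,9)+q\,\Sigma(1,-5,9)\bigr)\\ &\quad-\frac{1}{(q^{9};q^{9})_\infty[q^{4};q^{9}]_\infty}\bigl(q\,\Sigma(1,-8,9)+q^5\,\Sigma(4,1,9)\bigr),\\ A_1(q) &= \frac{(q^3;q^3)_\infty}{[q;q^3]_\infty},\\ A_2(q) &= 0. \end{align*}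
   Context: Here $q$ is a complex number with $0<|q|<1$. Notation: $(z;q)_\infty=\prod_{k\ge 0}(1-zq^k)$; $(z_1,\dots,z_m;q)_\infty=(z_1;q)_\infty\cdots(z_m;q)_\infty$; $[z;q]_\infty=(z,q/z;q)_\infty$. Define $$\widetilde{\mathrm{PP}}(z,q)=\sum_{n=1}^\infty \frac{q^n(q^{2n};q)_\infty}{(zq^n,z^{-1}q^n;q)_\infty}.$$ For complex arguments let $\Sigma(z,w,q)=\sum_{n=-\infty}^{\infty}\dfrac{q^{2n(n+1)}w^n}{1-zq^n}$, and for integers $a,b,c$ write $\Sigma(a,b,c)$ for $\Sigma(q^a,q^b,q^c)$, i.e. $\Sigma(a,b,c)=\sum_{n\in\mathbb Z}\dfrac{q^{2cn(n+1)+bn}}{1-q^{a+cn}}$. In $A_i(q^3)$ the variable $q$ is replaced by $q^3$ throughout, including inside the $\Sigma(a,b,c)$. *)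

(* Defs.v *)
From HB Require Import structures.
From mathcomp Require Import all_boot all_order all_algebra.
From mathcomp Require Import complex.
From mathcomp Require Import all_classical all_reals all_analysis.

Set Implicit Arguments.
Unset Strict Implicit.
Unset Printing Implicit Defensive.

Import Order.TTheory GRing.Theory Num.Theory.
Import numFieldNormedType.Exports.

Local Open Scope classical_set_scope.
Local Open Scope ring_scope.

(* All infinite sums and products are limits, for the topology of the norm,   *)
(* of the sequence of partial sums and products. The definitions make sense   *)
(* over any numFieldType; the intended one is R[i] with R : realType.         *)

Section qseries.
Variable C : numFieldType.
Implicit Types (z w q : C) (a b c : int).

(* (z; q)_oo *)
Definition qpoch z q : C := \big[*%R/1]_(0 <= k <oo) (1 - z * q ^+ k).

(* [z; q]_oo = (z, q / z; q)_oo *)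
Definition qtheta z q : C := qpoch z q * qpoch (q / z) q.

Definition PPtilde z q : C :=
  \big[+%R/0]_(1 <= n <oo)
    (q ^+ n * qpoch (q ^+ (2 * n)) q /
      (qpoch (z * q ^+ n) q * qpoch (z^-1 * q ^+ n) q)).

(* The two halves n >= 0 and n = -(k + 1) < 0 converge separately;            *)
(* Negz k is the integer -(k + 1).                                            *)
Definition bilateral_sum (f : int -> C) : C :=
  \big[+%R/0]_(0 <= k <oo) f (Posz k)
    + \big[+%R/0]_(0 <= k <oo) f (Negz k).

Definition Sigma z w q : C :=
  bilateral_sum (fun n => q ^ (2 * n * (n + 1)) * w ^ n / (1 - z * q ^ n)).

(* Sigma(a, b, c) for integers a, b, c, with the base q made explicit *)
Definition Sigmaz a b c q : C := Sigma (q ^ a) (q ^ b) (q ^ c).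

Definition A0 q : C :=
  qpoch (q ^+ 9) (q ^+ 9) * qtheta (q ^+ 3) (q ^+ 9)
    / (qtheta q (q ^+ 9) ^+ 2 * qtheta (q ^+ 4) (q ^+ 9))
  - 1 / (qpoch (q ^+ 9) (q ^+ 9) * qtheta (q ^+ 2) (q ^+ 9))
    * (Sigmaz 1 (-14) 9 q + q * Sigmaz 1 (-5) 9 q)
  - 1 / (qpoch (q ^+ 9) (q ^+ 9) * qtheta (q ^+ 4) (q ^+ 9))
    * (q * Sigmaz 1 (-8) 9 q + q ^+ 5 * Sigmaz 4 1 9 q).

Definition A1 q : C := qpoch (q ^+ 3) (q ^+ 3) / qtheta q (q ^+ 3).

Definition A2 q : C := 0.

End qseries.

(* Main.v *)
(* By a Bailey pair relative to 1, with beta_n = 1 / (q)_(2n-1) and hence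
   beta_0 = 0, the series PPtilde(z, q) equals (q)_oo^-1 times
     S(z) = sum_(i in Z) q^(6 i^2 + i) (1 - q^(2r)) q^r / ((1 - z q^r) (1 - q^r / z)),
   where r = 3 i + 1. The pair amounts to Schur's finite form of Euler's
   pentagonal identity, and the Bailey sum telescopes. At a primitive cube root
   of unity the denominator becomes (1 - q^(3r)) / (1 - q^r), so that splitting
   i modulo 3 writes S as a combination of twelve series Sigma(a, b, 9) in
   Q = q^3. Since (q)_oo = E (J_4 - q J_2 - q^2 J_1), with E = (Q^9; Q^9)_oo and
   J_k = [Q^k; Q^9]_oo, the theorem amounts to three identities, one for each
   power of q modulo Q. They follow from the partial fraction expansion of
   1 / ([b_1] [b_2] [b_3] [b_4]) into series Sigma, taken at b_i = Q^(a_i) for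
   the exponents {1,8,2,7}, {1,8,4,5}, {2,7,4,5}, {1,2,4,5} and {1,8,2,4};
   the first three expansions also imply J_2^2 J_4 - J_1 J_4^2 = Q J_1^2 J_2.
   The partial fraction expansion and the triple product are limits of Lagrange
   interpolation and of the q-binomial theorem, by Tannery's theorem. *)
Require Import Defs.
From mathcomp Require Import all_boot all_order all_algebra.
From mathcomp Require Import complex ring zify.
From mathcomp Require Import all_classical all_reals all_analysis.
Import Order.TTheory GRing.Theory Num.Theory.
Import numFieldNormedType.Exports.
Local Open Scope classical_set_scope.
Local Open Scope ring_scope.

(** * Geometric completeness of the complex numbers *)

(** The definitions live over any [numFieldType], where a geometrically bounded series need not
    converge. [geometrically_complete] isolates the two analytic facts from which everything is
    derived; [R[i]] is supplied only at the end. The main infinite identities are first proved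
    exactly on the window -N <= n < N, with terms bounded by [M * r ^+ absz n] uniformly in [N], and
    only then passed to the limit. The exponent in beta_n comes from (q^(2n))_oo = (q)_oo /
    (q)_(2n-1). Partial fractions are taken with four parameters because each contributes a weight
    (-1)^n q^(n(n+1)/2): the product of four has no sign and is exactly the q^(2n(n+1)) of [Sigma].
    Series at residues a and 9 - a are exchanged by n -> -n-1, so the expansions, whose exponents
    are mostly paired in this way, involve few independent combinations. *)

Definition geometrically_complete (C : numFieldType) : Prop :=
  (forall q : C, `|q| < 1 -> (q ^+ n) @[n --> \oo] --> (0 : C)) /\
  (forall (u : nat -> C) (M r : C), 0 <= r < 1 ->
     (forall n, `|u n| <= M * r ^+ n) -> cvgn (series u)).

Section ComplexComplete.
Variable R : realType.
Let C : numFieldType := R[i].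

Lemma cvg_real_complex (u : nat -> R) (l : R) :
  u @ \oo --> l -> (fun n => (u n)%:C%C : C) @ \oo --> (l%:C%C : C).
Proof.
move=> /cvgrPdist_lt ul; apply/cvgrPdist_lt => e e0.
(* In the order of [R[i]], a positive element is real, so [e] may be compared with real
   quantities. *)
have eE : e = (complex.Re e)%:C%C by rewrite RRe_real// gtr0_real.
have Re0 : 0 < complex.Re e by move: e0; rewrite {1}eE (ltcR 0).
apply: filterS (ul _ Re0) => n un.
by rewrite -rmorphB normc_def /= expr0n addr0 sqrtr_sqr eE ltcR.
Qed.

Lemma cvg_expr_complex (q : C) : `|q| < 1 -> (q ^+ n) @[n --> \oo] --> (0 : C).
Proof.
move=> q1; apply/cvgrPdist_lt => e e0.
have qE : `|q| = (complex.Re `|q|)%:C%C :> C by rewrite RRe_real// normr_real.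
have r1 : `|complex.Re `|q| : R| < 1.
  by rewrite -ltcR (le_lt_trans (normc_ge_Re _))// normr_id.
have /cvg_real_complex/cvgrPdist_lt/(_ e e0) := cvg_expr r1.
have qnE n : `|q| ^+ n = (complex.Re `|q| ^+ n)%:C%C :> C by rewrite rmorphXn /=;
  congr (_ ^+ _); exact: qE.
by apply: filterS => n; rewrite !sub0r !normrN -qnE normrX normrX normr_id.
Qed.

(** The hypotheses force [M] and [r] to be real, so the bound descends to the real parts and
    comparison with a real geometric series applies. *)
Lemma cvg_series_Re (u : nat -> C) (M r : C) : 0 <= r < 1 ->
  (forall n, `|u n| <= M * r ^+ n) ->
  cvgn (series (fun n => complex.Re (u n))).
Proof.
move=> /andP[r0 r1] uM.
have rE : r = (complex.Re r)%:C%C by rewrite RRe_real// ger0_real.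
have Rr0 : 0 <= complex.Re r by move: r0; rewrite {1}rE lecR.
have Rr1 : complex.Re r < 1 by move: r1; rewrite {1}rE ltcR.
have M0 : 0 <= M by have := uM 0%N; rewrite expr0 mulr1; apply: le_trans.
have ME : M = (complex.Re M)%:C%C by rewrite RRe_real// ger0_real.
apply: normed_cvg; apply: (@series_le_cvg _ _ (geometric (complex.Re M) (complex.Re r))).
- by move=> n; exact: normr_ge0.
- move=> n; rewrite /geometric/= mulr_ge0 ?exprn_ge0//.
  by move: M0; rewrite {1}ME lecR.
- move=> n; rewrite /geometric/=.
  rewrite -lecR (le_trans (normc_ge_Re _))// (le_trans (uM n))//.
  by rewrite rmorphM rmorphXn /= -rE -ME.
- by apply: is_cvg_geometric_series; rewrite ger0_norm.
Qed.

Lemma complex_geometrically_complete : geometrically_complete C.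
Proof.
split=> [|u M r r01 uM]; first exact: cvg_expr_complex.
have /cvg_ex[a Ha] := cvg_series_Re _ _ _ r01 uM.
(* The imaginary parts are reached through ['i * u], whose real part is [- Im u]; hence the minus
   sign in the limit. *)
have iuM n : `|'i%C * u n : C| <= M * r ^+ n.
  by rewrite normrM normc_def /= expr0n add0r expr1n sqrtr1 mul1r.
have /cvg_ex[b Hb] := cvg_series_Re _ _ _ r01 iuM.
apply/cvg_ex; exists (a%:C - 'i * b%:C)%C.
suff -> : series u = (fun n =>
    (series (fun n => complex.Re (u n)) n)%:C%C
    - 'i%C * (series (fun n => complex.Re ('i%C * u n)) n)%:C%C).
  exact: cvgB (cvg_real_complex _ _ Ha)
    (cvgM (cvg_cst ('i%C : C)) (cvg_real_complex _ _ Hb)).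
apply/funext => n.
rewrite /series /= 2!(rmorph_sum (real_complex R)) mulr_sumr -sumrB.
apply: eq_bigr => k _.
have -> : complex.Re ('i%C * u k) = - complex.Im (u k) by rewrite mulrC ReiNIm.
by rewrite [LHS]complexE rmorphN mulrN opprK.
Qed.

End ComplexComplete.

(** * Tannery's theorem *)

Section Tannery.
Variable C : numFieldType.
Implicit Types (M r : C) (f g : nat -> C).

Lemma cvg_subseq (u : nat -> C) (l : C) (phi : nat -> nat) :
  (forall n, n <= phi n)%N -> u @ \oo --> l -> (u \o phi) @ \oo --> l.
Proof.
move=> phin ul; apply: cvg_comp ul => P [N _ NP].
by exists N => // n /= Nn; apply: NP => /=; apply: leq_trans (phin n).
Qed.

Lemma cvgn_bounded (u : nat -> C) (l : C) :
  u @ \oo --> l -> exists2 B : C, 0 < B & forall n, `|u n| <= B.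
Proof.
move=> ul; have /ex_strict_bound_gt0 : bounded_fun u.
  by apply: cvg_seq_bounded; apply/cvg_ex; exists l.
by case=> B B0 uB; exists B => // n; apply/ltW/uB.
Qed.

Lemma cvgn_norm_le (u : nat -> C) (l B : C) :
  u @ \oo --> l -> (forall n, `|u n| <= B) -> `|l| <= B.
Proof.
move=> ul uB; have Breal : B \is Num.real.
  by rewrite ger0_real// (le_trans _ (uB 0%N)).
rewrite real_leNgt ?normr_real//; apply/negP => Bl.
have /cvgrPdist_lt/(_ (`|l| - B)) := ul.
rewrite subr_gt0 => /(_ Bl)[N _ /(_ N (leqnn N)) /= lN].
have : `|l| < `|l|.
  rewrite (le_lt_trans (_ : _ <= `|l - u N| + `|u N|))//.
    by rewrite -{1}(subrK (u N) l) ler_normD.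
  by rewrite -[ltRHS](subrK B) ltr_leD.
by rewrite ltxx.
Qed.

Lemma cvgn_sum (I : Type) (s : seq I) (P : pred I) (F : nat -> I -> C) (l : I -> C) :
  (forall i, P i -> (F ^~ i) @ \oo --> l i) ->
  (fun n => \sum_(i <- s | P i) F n i) @ \oo --> \sum_(i <- s | P i) l i.
Proof.
move=> Fl; elim: s => [|i s IH].
  rewrite big_nil; under eq_fun do rewrite big_nil; exact: cvg_cst.
rewrite big_cons; under eq_fun do rewrite big_cons.
by case: ifP => // Pi; apply: cvgD => //; apply: Fl.
Qed.

Lemma cvgn_prod (I : Type) (s : seq I) (P : pred I) (F : nat -> I -> C) (l : I -> C) :
  (forall i, P i -> (F ^~ i) @ \oo --> l i) ->
  (fun n => \prod_(i <- s | P i) F n i) @ \oo --> \prod_(i <- s | P i) l i.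
Proof.
move=> Fl; elim: s => [|i s IH].
  rewrite big_nil; under eq_fun do rewrite big_nil; exact: cvg_cst.
rewrite big_cons; under eq_fun do rewrite big_cons.
by case: ifP => // Pi; apply: cvgM => //; apply: Fl.
Qed.

Lemma geometric_tail_le r K N : 0 <= r < 1 ->
  \sum_(K <= k < N) r ^+ k <= r ^+ K / (1 - r).
Proof.
move=> /andP[r0 r1]; have r1' : 0 < 1 - r by rewrite subr_gt0.
rewrite ler_pdivlMr//; have [KN|NK] := leqP K N; last first.
  by rewrite big_geq ?mul0r ?exprn_ge0// ltnW.
suff -> : (\sum_(K <= k < N) r ^+ k) * (1 - r) = r ^+ K - r ^+ N.
  by rewrite lerBlDr lerDl exprn_ge0.
rewrite mulr_suml; transitivity (\sum_(K <= k < N) (- r ^+ k.+1 - - r ^+ k)).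
  by apply: eq_bigr => k _; rewrite mulrBr mulr1 -exprSr opprK addrC.
by rewrite (telescope_sumr (fun k => - r ^+ k))// opprK addrC.
Qed.

Hypothesis gcC : geometrically_complete C.

Lemma geometric_eventually_lt M r e : 0 <= M -> 0 <= r < 1 -> 0 < e ->
  \forall K \near \oo, M * r ^+ K < e.
Proof.
move=> M0 /andP[r0 r1] e0.
have r1n : `|r| < 1 by rewrite ger0_norm.
have M1 : 0 < M + 1 by rewrite ltr_wpDl.
have /cvgrPdist_lt/(_ (e / (M + 1))) := gcC.1 r r1n.
rewrite divr_gt0// => /(_ isT); apply: filterS => K.
rewrite sub0r normrN ger0_norm ?exprn_ge0// ltr_pdivlMr// => h.
apply: le_lt_trans h; rewrite mulrC ler_wpM2l ?exprn_ge0//.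
by rewrite lerDl.
Qed.

(** The range of summation grows with the parameter, as it does in the finite identities. The bound
    passes to [g], so [limn (series g)] is a true limit. With [K] fixed so that the geometric tail
    and the tail of [series g] are below e/3, only [K] termwise limits remain. *)
Lemma tannery (f : nat -> nat -> C) (g : nat -> C) M r : 0 <= r < 1 ->
  (forall N n, `|f N n| <= M * r ^+ n) ->
  (forall n, (f ^~ n) @ \oo --> g n) ->
  (fun N => \sum_(0 <= n < N) f N n) @ \oo --> limn (series g).
Proof.
move=> r01 fM fg; have [r0 r1] := andP r01.
have M0 : 0 <= M by have := fM 0%N 0%N; rewrite mulr1; apply: le_trans.
have gM n : `|g n| <= M * r ^+ n by apply: cvgn_norm_le (fg n) _ => N.
have /cvg_ex[S gS] : cvgn (series g) by apply: gcC.2 r01 gM.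
rewrite (cvg_lim (@norm_hausdorff _ C) gS).
apply/cvgrPdist_lt => e e0.
have e3 : 0 < e / 3 by rewrite divr_gt0.
have M1 : 0 <= M / (1 - r) by rewrite divr_ge0// subr_ge0 ltW.
have [K [MK SK]] : exists K, M / (1 - r) * r ^+ K < e / 3 /\
    `|S - series g K| < e / 3.
  have /cvgrPdist_lt/(_ _ e3) gS3 := gS.
  have [K _ HK] := filterI (geometric_eventually_lt _ _ _ M1 r01 e3) gS3.
  by exists K; apply: HK => /=.
have /cvgrPdist_lt/(_ _ e3) fK := cvgn_sum _ (index_iota 0 K) xpredT _ _ (fun n _ => fg n).
near=> N.
have KN : (K <= N)%N by near: N; exists K.
have -> : S - \sum_(0 <= n < N) f N n =
    (S - series g K) + (\sum_(0 <= n < K) g n - \sum_(0 <= n < K) f N n)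
    - \sum_(K <= n < N) f N n.
  rewrite (big_cat_nat (leq0n K) KN)//= /series/=.
  by rewrite addrA subrK opprD addrA.
have -> : e = e / 3 + e / 3 + e / 3.
  by field.
apply: le_lt_trans (ler_normB _ _) _; apply: ltr_leD.
  apply: le_lt_trans (ler_normD _ _) _; apply: ltrD => //.
  by near: N; apply: fK.
apply: ltW; apply: le_lt_trans MK; apply: le_trans (ler_norm_sum _ _ _) _.
apply: le_trans (_ : \sum_(K <= i < N) M * r ^+ i <= _).
  by apply: ler_sum => i _.
by rewrite -mulr_sumr -mulrA ler_wpM2l// mulrC geometric_tail_le.
Unshelve. all: by end_near.
Qed.

(** Pairing [k] with -(k+1), as [bilateral_sum] does, gives the window -N <= n < N, which is not
    symmetric about 0. This asymmetry explains the shifts by one in the finite identities. *)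
Definition bsum (N : nat) (f : int -> C) : C :=
  \sum_(0 <= k < N) (f (Posz k) + f (Negz k)).

Lemma bsum_tannery (f : nat -> int -> C) (g : int -> C) M r : 0 <= r < 1 ->
  (forall N n, `|f N n| <= M * r ^+ `|n|%N) ->
  (forall n, (f ^~ n) @ \oo --> g n) ->
  (fun N => bsum N (f N)) @ \oo --> bilateral_sum g.
Proof.
move=> r01 fM fg; have [r0 r1] := andP r01.
have M0 : 0 <= M by have := fM 0%N 0; rewrite mulr1; apply: le_trans.
rewrite /bsum; under eq_fun do rewrite big_split/=.
apply: cvgD.
  by apply: (tannery (fun N k => f N (Posz k)) (g \o Posz) M r r01).
apply: (tannery (fun N k => f N (Negz k)) (g \o Negz) M r r01) => // N n.
apply: le_trans (fM N (Negz n)) _.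
by rewrite ler_wpM2l//= exprS ler_piMl ?exprn_ge0// ltW.
Qed.

Definition bdominated (f : int -> C) : Prop :=
  exists M r : C, 0 <= r < 1 /\ forall n, `|f n| <= M * r ^+ `|n|%N.

Lemma bsum_cvg (f : int -> C) : bdominated f ->
  (fun N => bsum N f) @ \oo --> bilateral_sum f.
Proof.
move=> [M [r [r01 fM]]].
by apply: (bsum_tannery (fun=> f) f M r r01) => // n; apply: cvg_cst.
Qed.

Lemma bilateral_sum_unique (f : int -> C) (l : C) : bdominated f ->
  (fun N => bsum N f) @ \oo --> l -> bilateral_sum f = l.
Proof. by move=> /bsum_cvg h1 h2; apply: cvg_unique h1 h2. Qed.

End Tannery.

Arguments bsum {C}.
Arguments bdominated {C}.

(** * q-Pochhammer symbols *)

Definition qp {C : numFieldType} (z q : C) (n : nat) : C :=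
  \prod_(0 <= k < n) (1 - z * q ^+ k).

Section QPochhammer.
Variable C : numFieldType.
Hypothesis gcC : geometrically_complete C.
Variable q : C.
Hypothesis q1 : `|q| < 1.
Implicit Types (z : C) (n : nat).

Lemma qp0 z : qp z q 0 = 1. Proof. by rewrite /qp big_nil. Qed.

Lemma qpS z n : qp z q n.+1 = qp z q n * (1 - z * q ^+ n).
Proof. by rewrite /qp big_nat_recr. Qed.

Lemma qpD z m n : qp z q (m + n) = qp z q m * qp (z * q ^+ m) q n.
Proof.
elim: n => [|n IH]; first by rewrite addn0 qp0 mulr1.
by rewrite addnS !qpS IH -mulrA -[in RHS]mulrA -exprD.
Qed.

Lemma qp_neq0 z n : (forall k, z * q ^+ k != 1) -> qp z q n != 0.
Proof.
move=> zq; elim: n => [|n IH]; first by rewrite qp0 oner_neq0.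
by rewrite qpS mulf_neq0// subr_eq0 eq_sym.
Qed.

(** Induction from P (1 - x) - 1 = (P - 1) - x (P - 1) - x: the hypothesis keeps |P - 1| at most 1,
    so a new factor costs at most 2 |x|. *)
Lemma prod_near1 (x : nat -> C) K n : \sum_(K <= k < n) `|x k| <= 2^-1 ->
  `|\prod_(K <= k < n) (1 - x k) - 1| <= 2 * \sum_(K <= k < n) `|x k|.
Proof.
have [nK _|Kn] := leqP n K; first by rewrite !big_geq// subrr normr0 mulr0.
rewrite -(subnK (ltnW Kn)); elim: (n - K)%N => [|m IH].
  by rewrite !big_geq// subrr normr0 mulr0.
rewrite addSn !big_nat_recr ?leq_addl//= => h.
have xm0 := normr_ge0 (x (m + K)%N).
have {}IH : `|\prod_(K <= k < m + K) (1 - x k) - 1|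
    <= 2 * \sum_(K <= k < m + K) `|x k|.
  by apply: IH; apply: le_trans h; rewrite lerDl.
set P := \prod_(_ <= _ < _) _ in IH *; set S := \sum_(_ <= _ < _) _ in IH h *.
have -> : P * (1 - x (m + K)%N) - 1 = (P - 1) - x (m + K)%N * (P - 1) - x (m + K)%N.
  by ring.
apply: le_trans (ler_normB _ _) _.
have -> : 2 * (S + `|x (m + K)%N|) = (2 * S + `|x (m + K)%N|) + `|x (m + K)%N|.
  by ring.
apply: lerD => //; apply: le_trans (ler_normB _ _) _; apply: lerD => //.
rewrite normrM -[leRHS]mulr1; apply: ler_pM => //.
apply: le_trans IH _.
have S2 : S <= 2^-1 by apply: le_trans h; rewrite lerDl.
by rewrite -[leRHS](@mulfV _ 2)// ler_wpM2l.
Qed.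

Lemma q01 : 0 <= `|q| < 1. Proof. by rewrite normr_ge0 q1. Qed.

(** Past [K] the remaining factors multiply to within 1/2 of 1. The upper bound serves convergence;
    the lower one serves nonvanishing of the infinite product. *)
Lemma qp_stable z : exists K, forall n, (K <= n)%N ->
  `|qp z q K| / 2 <= `|qp z q n| <= `|qp z q K| * 2.
Proof.
have q1' : 0 < 1 - `|q| by rewrite subr_gt0.
have z0 : 0 <= `|z| / (1 - `|q|) by rewrite divr_ge0// ltW.
have h4 : 0 < 4^-1 :> C by rewrite invr_gt0.
have [K _ HK] := geometric_eventually_lt _ gcC _ _ _ z0 q01 h4.
exists K => n Kn; have {}HK := HK K (leqnn K).
have sumle : \sum_(K <= k < n) `|z * q ^+ k| <= 4^-1.
  under eq_bigr do rewrite normrM normrX.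
  rewrite -mulr_sumr; apply: le_trans (ltW HK) => /=.
  by rewrite -mulrA ler_wpM2l// mulrC geometric_tail_le// q01.
have h24 : 4^-1 <= 2^-1 :> C by rewrite lef_pV2 ?posrE// ler_nat.
have := prod_near1 _ _ _ (le_trans sumle h24).
set P := \prod_(_ <= _ < _) _ => P1.
have {}P1 : `|P - 1| <= 2^-1.
  apply: le_trans P1 _; apply: le_trans (ler_wpM2l _ sumle) _ => //.
  by rewrite -[4]/(2 * 2)%:R natrM invfM mulrA mulfV// mul1r.
have -> : qp z q n = qp z q K * P by rewrite /qp (big_cat_nat (leq0n K) Kn).
rewrite normrM !ler_wpM2l//.
  have -> : P = (P - 1) + 1 by rewrite subrK.
  apply: le_trans (ler_normD _ _) _; rewrite normr1.
  have -> : 2 = 1 + 1 :> C by [].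
  by rewrite lerD2r (le_trans P1)// invf_le1// ler1n.
rewrite -(lerD2r (`|P - 1|)).
apply: le_trans (_ : 1 <= _).
  by rewrite [leRHS](splitr 1) !mul1r lerD2l.
have := ler_normB P (P - 1).
by have -> : P - (P - 1) = 1 by [ring]; rewrite normr1.
Qed.

(** [qpoch] is by definition the limit, so only convergence is at stake. The increments
    [- (qp z q n * (z * q ^+ n))] are geometrically small because the products are bounded. *)
Lemma qp_cvg z : (fun n => qp z q n) @ \oo --> qpoch z q.
Proof.
suff : cvgn (fun n => qp z q n) by [].
have [K HK] := qp_stable z.
pose u n := qp z q n.+1 - qp z q n.
have uE n : u n = - (qp z q n * (z * q ^+ n)).
  by rewrite /u qpS; ring.
have [B [B0 HB]] : exists B : C, 0 <= B /\ forall n, `|qp z q n| <= B.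
  exists (`|qp z q K| * 2 + \sum_(0 <= n < K) `|qp z q n|); split.
    by rewrite addr_ge0 ?mulr_ge0// sumr_ge0.
  move=> n; have [nK|/HK/andP[_ h]] := ltnP n K; last first.
    by apply: le_trans h _; rewrite lerDl sumr_ge0.
  apply: le_trans (_ : \sum_(0 <= n < K) `|qp z q n| <= _).
    rewrite (big_cat_nat (leq0n n) (ltnW nK))//= (big_ltn nK).
    by rewrite addrCA lerDl addr_ge0// sumr_ge0.
  by rewrite lerDr mulr_ge0.
have /cvg_ex[l ul] : cvgn (series u).
  apply: (gcC.2 u (B * `|z|) `|q| q01) => n.
  rewrite uE normrN !normrM normrX -mulrA.
  by apply: ler_pM => //; rewrite mulr_ge0 ?exprn_ge0.
apply/cvg_ex; exists (l + 1).
have -> : (fun n => qp z q n) = (fun n => series u n + 1).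
  apply/funext => n; rewrite /series /= telescope_sumr// qp0 subrK//.
by apply: cvgD => //; apply: cvg_cst.
Qed.

Lemma qpoch_neq0 z : (forall k, z * q ^+ k != 1) -> qpoch z q != 0.
Proof.
move=> zq; have [K HK] := qp_stable z; apply/eqP => z0.
have K0 : 0 < `|qp z q K| / 2 by rewrite divr_gt0// normr_gt0 qp_neq0.
have /cvgrPdist_lt/(_ _ K0)[N _ HN] := qp_cvg z.
have := HN (maxn K N) (leq_maxr _ _); rewrite /= z0 sub0r normrN => h.
have /andP[h' _] := HK _ (leq_maxl K N).
by have := le_lt_trans h' h; rewrite ltxx.
Qed.

Lemma qpV_cvg z : (forall k, z * q ^+ k != 1) ->
  (fun n => (qp z q n)^-1) @ \oo --> (qpoch z q)^-1.
Proof. by move=> zq; apply: cvgV; [apply: qpoch_neq0|apply: qp_cvg]. Qed.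

Lemma qpV_bounded z : (forall k, z * q ^+ k != 1) ->
  exists2 B : C, 0 < B & forall n, `|(qp z q n)^-1| <= B.
Proof. by move=> zq; apply: cvgn_bounded (qpV_cvg z zq). Qed.

Lemma qpoch_split z m : qpoch z q = qp z q m * qpoch (z * q ^+ m) q.
Proof.
have h1 : (fun n => qp z q m * qp (z * q ^+ m) q n) @ \oo -->
    qp z q m * qpoch (z * q ^+ m) q.
  by apply: cvgM; [exact: cvg_cst | exact: qp_cvg].
have h2 : (fun n => qp z q m * qp (z * q ^+ m) q n) @ \oo --> qpoch z q.
  have := cvg_subseq _ _ _ (addn m) (leq_addl m) (qp_cvg z).
  apply: cvg_trans; apply: near_eq_cvg; apply: nearW => n /=.
  by rewrite qpD.
exact: cvg_unique h2 h1.
Qed.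

Lemma qpoch_rec z : qpoch z q = (1 - z) * qpoch (z * q) q.
Proof. by rewrite (qpoch_split z 1) qpS qp0 expr0 expr1 mulr1 mul1r. Qed.

Lemma qtheta_inv z : z != 0 -> qtheta z^-1 q = - z^-1 * qtheta z q.
Proof.
move=> z0; rewrite /qtheta invrK (qpoch_rec z^-1) (qpoch_rec z) (mulrC q z) (mulrC q).
by field.
Qed.

Lemma qtheta_sym z : z != 0 -> q != 0 -> qtheta (q / z) q = qtheta z q.
Proof. by move=> z0 qn0; rewrite /qtheta invf_div mulrCA mulfV// mulr1 mulrC. Qed.

Hypothesis qn0 : q != 0.

Lemma qtheta_neq0 z : z != 0 -> (forall n : int, z * q ^ n != 1) ->
  qtheta z q != 0.
Proof.
move=> z0 zq; rewrite /qtheta mulf_neq0//; apply: qpoch_neq0 => k.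
  exact: (zq (Posz k)).
apply/negP => /eqP h; have /eqP := zq (- (Posz k.+1)); apply.
have -> : z = q ^+ k.+1 by rewrite -[z]mul1r -h exprS mulrAC divfK.
by rewrite -exprnN mulfV// expf_neq0.
Qed.

End QPochhammer.

(** * Lagrange partial fractions *)

(** Interpolate ['X^m] at the nodes [(t i)^-1]: the difference [P] has size at most [#|I|] and
    [#|I|] distinct roots, hence is 0. Then evaluate at 1. The free exponent [m] is what later
    centres the windows. *)
Lemma lagrange_partial_fractions (F : fieldType) (I : finType) (t : I -> F) (m : nat) :
  injective t -> (forall i, t i != 0) -> (forall i, t i != 1) -> (m < #|I|)%N ->
  \prod_i (1 - t i)^-1 =
  \sum_i t i ^- m * (1 - t i)^-1 * \prod_(j | j != i) (1 - t j / t i)^-1.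
Proof.
move=> tinj t0 t1 mI.
have tij i j : j != i -> 1 - t j / t i != 0.
  move=> ji; rewrite subr_eq0 eq_sym; apply: contra ji => /eqP h.
  by apply/eqP/tinj; rewrite -[t j](divfK (t0 i)) h mul1r.
pose c i := t i ^- m * \prod_(j | j != i) (1 - t j / t i)^-1.
pose L i : {poly F} := \prod_(j | j != i) (1 - t j *: 'X).
pose P : {poly F} := 'X^m - \sum_i c i *: L i.
have LE i x : (L i).[x] = \prod_(j | j != i) (1 - t j * x).
  by rewrite /L horner_prod; apply: eq_bigr => j _; rewrite !hornerE.
have sizeL i : (size (L i) <= #|I|)%N.
  apply: leq_trans (size_prod_leq _ _) _.
  have -> : #|I| = #|predC1 i|.+1.
    by rewrite cardC1 prednK//; apply/card_gt0P; exists i.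
  rewrite leq_subLR addnS ltnS -sum1_card -big_split/=.
  apply: leq_sum => j _; rewrite addn1.
  apply: leq_trans (size_polyD _ _) _; rewrite size_poly1 geq_max/= size_polyN.
  by apply: leq_trans (size_scale_leq _ _) _; rewrite size_polyX.
have P0 : P = 0.
  apply/eqP; apply/negPn/negP => Pn0.
  have := max_poly_roots Pn0 (rs := [seq (t i)^-1 | i <- enum I]).
  rewrite size_map -cardE => H.
  have {H} : (#|I| < size P)%N.
    apply: H; last by rewrite map_inj_uniq ?enum_uniq// => i j /invr_inj/tinj.
    apply/allP => x /mapP[i _ ->]; rewrite /root /P !hornerE horner_sum.
    rewrite (bigD1 i)//= hornerZ LE [X in _ - (_ + X)]big1 => [|k ki]; last first.
      rewrite hornerZ LE (bigD1 i) 1?eq_sym//= mulfV// subrr mul0r mulr0//.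
    rewrite addr0 /c -mulrA -big_split/= big1 => [|j ji].
      by rewrite mulr1 exprVn subrr.
    by rewrite mulVf// tij.
  rewrite ltnNge => /negP; apply.
  apply: leq_trans (size_polyD _ _) _; rewrite geq_max size_polyXn mI/= size_polyN.
  apply: leq_trans (size_sum _ _ _) _; apply/bigmax_leqP => i _.
  exact: leq_trans (size_scale_leq _ _) _.
have /eqP := congr1 (horner^~ 1) P0.
rewrite /P !hornerE horner_sum expr1n subr_eq0 => /eqP h.
set Q := \prod_i _; rewrite -[LHS]mul1r [X in X * Q]h mulr_suml; apply: eq_bigr => i _.
rewrite hornerZ LE /c /Q [\prod_k (1 - t k)^-1](bigD1 i)//=.
have -> : \prod_(j | j != i) (1 - t j * 1) = \prod_(j | j != i) (1 - t j).
  by apply: eq_bigr => j _; rewrite mulr1.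
have hp : \prod_(j | j != i) (1 - t j) * \prod_(j | j != i) (1 - t j)^-1 = 1.
  rewrite -big_split/= big1// => j _; rewrite mulfV//.
  by rewrite subr_eq0 eq_sym.
set A := \prod_(j | j != i) (1 - t j / t i)^-1.
set B := \prod_(j | j != i) (1 - t j)^-1 in hp *.
set D := \prod_(j | j != i) (1 - t j) in hp *.
transitivity (t i ^- m * A * (1 - t i)^-1 * (D * B)); first by ring.
by rewrite hp mulr1 mulrAC.
Qed.

(** * Triangular numbers and products over windows of powers of q *)

Definition tri (n : int) : int := ((n * (n + 1)) %/ 2)%Z.

Lemma tri_double n : tri n * 2 = n * (n + 1).
Proof.
rewrite /tri divzK//; apply/dvdzP.
have : (n %% 2)%Z = 0 \/ (n %% 2)%Z = 1 by lia.
have := divz_eq n 2; set k := (n %/ 2)%Z; case=> + [] h; rewrite h => ->.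
  by exists (k * (k * 2 + 1)); ring.
by exists ((k * 2 + 1) * (k + 1)); ring.
Qed.

Lemma triE n m : m * 2 = n * (n + 1) -> tri n = m.
Proof. by rewrite -tri_double => /(mulIf _) ->. Qed.

Lemma triD m n : tri (m + n) = tri m + tri n + m * n.
Proof. by apply: triE; rewrite !mulrDl !tri_double; ring. Qed.

Lemma tri_natS (n : nat) : tri n.+1%:Z = tri n%:Z + n.+1%:Z.
Proof. by apply: triE; rewrite !mulrDl !tri_double -!natz -natr1; ring. Qed.

Lemma tri_opp n : tri (- n) = tri n - n.
Proof. by apply: triE; rewrite mulrBl tri_double; ring. Qed.

Lemma bsum_window (C : numFieldType) N (f : int -> C) :
  bsum N f = \sum_(0 <= m < N.*2) f (m%:Z - N%:Z).
Proof.
elim: N => [|N IH]; first by rewrite /bsum !big_nil.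
rewrite /bsum big_nat_recr//= -/(bsum N f) IH doubleS.
rewrite big_nat_recl// big_nat_recr//= sub0r -NegzE.
have -> : N.*2.+1%:Z - N.+1%:Z = N%:Z by lia.
have -> : \sum_(0 <= m < N.*2) f (m.+1%:Z - N.+1%:Z)
  = \sum_(0 <= m < N.*2) f (m%:Z - N%:Z).
  by apply: eq_bigr => m _; congr f; lia.
by rewrite addrA addrC.
Qed.

Section Windows.
Variable (C : numFieldType) (q : C).
Hypothesis q0 : q != 0.

(* The coefficients of the Jacobi triple product. *)
Definition tsgn (n : int) : C := (-1) ^ n * q ^ tri n.

(** Each factor at a negative power is turned around, 1 - z q^(-u) = - z q^(-u) (1 - q^u / z); the
    collected monomials are the source of all Gaussian powers. *)
Lemma prod_back (z : C) (m : nat) : z != 0 ->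
  \prod_(0 <= u < m) (1 - z * q ^ (u%:Z - m%:Z)) =
  (- z) ^+ m * q ^ (- tri m%:Z) * qp (q / z) q m.
Proof.
move=> z0; rewrite big_nat_rev/=.
transitivity (\prod_(0 <= u < m) (1 - z * q ^ (- u.+1%:Z))).
  rewrite big_nat [RHS]big_nat; apply: eq_bigr => u /andP[_ um].
  by congr (1 - z * q ^ _); lia.
elim: m => [|m IH]; first by rewrite big_nil qp0 expr0 mul1r mulr1.
rewrite big_nat_recr//= IH qpS exprS tri_natS opprD expfzDr//.
have -> : q ^ (- m.+1%:Z) = (q * q ^+ m)^-1 by rewrite -exprnN exprS.
have := expf_neq0 m q0; set Q := q ^+ m => Q0.
by field; apply/and3P.
Qed.

Lemma prod_window (z : C) (m N : nat) : z != 0 -> (m <= N)%N ->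
  \prod_(0 <= u < N) (1 - z * q ^ (u%:Z - m%:Z)) =
  (- z) ^+ m * q ^ (- tri m%:Z) * qp (q / z) q m * qp z q (N - m).
Proof.
move=> z0 mN; rewrite (big_cat_nat (leq0n m) mN)/= prod_back//; congr (_ * _).
rewrite -{1}(add0n m) big_addn /qp; apply: eq_bigr => k _.
by rewrite PoszD addrK.
Qed.

Lemma prod_window_punctured (m N : nat) : (m < N)%N ->
  \prod_(0 <= u < N | u != m) (1 - q ^ (u%:Z - m%:Z)) =
  (- 1) ^+ m * q ^ (- tri m%:Z) * qp q q m * qp q q (N - m.+1).
Proof.
move=> mN; rewrite (big_cat_nat (leq0n m) (ltnW mN))/=; congr (_ * _).
  have := prod_back 1 m (oner_neq0 C); rewrite divr1 => <-.
  rewrite [LHS]big_nat_cond [RHS]big_nat_cond; apply: eq_big => [u|u _].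
    by rewrite andbT; case: ltngtP; rewrite ?andbF//= ?andbT.
  by rewrite mul1r.
rewrite big_ltn_cond// eqxx/= -{1}(add0n m.+1) big_addn /qp.
apply: eq_big => [k|k _]; first by apply/eqP; lia.
by congr (1 - _); rewrite -exprS exprnP; congr (_ ^ _); lia.
Qed.

End Windows.
Arguments tsgn {C}.

(** Collects the monomials that one index j contributes to Lagrange interpolation. With n = m - N,
    the relation tri n = tri m - tri N - N n removes every separate trace of [N], leaving the Jacobi
    weight at n. *)
Lemma window_monomial (C : numFieldType) (q x y : C) (m N : nat) : q != 0 -> x != 0 -> y !=
  0 ->
  (- x) ^+ N * q ^ (- tri N%:Z) * (y * q ^ (m%:Z - N%:Z)) ^- N
    * ((- (x / y)) ^+ m * q ^ (- tri m%:Z))^-1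
  = (y / x) ^ (m%:Z - N%:Z) * tsgn q (m%:Z - N%:Z).
Proof.
move=> q0 x0 y0; rewrite /tsgn; set n := m%:Z - N%:Z.
have -> : tri n = tri m%:Z - tri N%:Z - N%:Z * n.
  by apply: triE; rewrite !mulrBl !tri_double /n; ring.
have -> : q ^ (tri m - tri N - N%:Z * n) = q ^ tri m * q ^ (- tri N) * (q ^ n) ^- N.
  have <- : q ^ (- (N%:Z * n)) = (q ^ n) ^- N.
    by rewrite [RHS]exprnN exprz_exp; congr (_ ^ _); ring.
  by rewrite !expfzDr.
rewrite (exprMn _ y) invfM (invfM ((- (x/y)) ^+ m)) invr_expz opprK.
have -> : (y / x) ^ n = y ^+ m * y ^- N * x ^+ N * x ^- m.
  by rewrite expfzMl exprz_inv /n opprB !expfzDr// exprnP -!exprnN -!exprnP; ring.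
have -> : (-1 : C) ^ n = (-1) ^+ N * (-1) ^- m.
  by rewrite /n expfzDr ?oppr_eq0 ?oner_eq0// -exprnN -exprnP -!exprVn invrN1 mulrC.
rewrite -[- x]mulN1r -[- (x / y)]mulN1r !exprMn !exprVn !invfM !invrK.
ring.
Qed.

Section FinitePartialFractions.
Variables (C : numFieldType) (q : C) (I : finType) (b : I -> C).
Hypothesis q0 : q != 0.
Hypothesis qZ : forall n : int, n != 0 -> q ^ n != 1.
Hypothesis b0 : forall i, b i != 0.
Hypothesis bq1 : forall i (n : int), b i * q ^ n != 1.
Hypothesis bq : forall i j (n : int), i != j -> b i * q ^ n != b j.

(** Lagrange interpolation at the points b_i q^n with -N <= n < N. On this window the arguments of
    [absz] are nonnegative, so [absz] is a mere conversion to [nat]. *)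
Lemma theta_partial_fractions_finite (N : nat) : (0 < N)%N -> (0 < #|I|)%N ->
  \prod_i (qp (b i) q N * qp (q / b i) q N)^-1 =
  \sum_i bsum N (fun n : int =>
    \prod_j ((b i / b j) ^ n * tsgn q n) / (1 - b i * q ^ n)
    * (qp q q (absz (N%:Z + n)%R) * qp q q (absz (N%:Z - n - 1)%R))^-1
    * \prod_(j | j != i) (qp (q / (b j / b i)) q (absz (N%:Z + n)%R)
                          * qp (b j / b i) q (absz (N%:Z - n)%R))^-1).
Proof.
move=> N0 I0.
pose t (p : I * 'I_(N.*2)) := b p.1 * q ^ (p.2%:Z - N%:Z).
have tinj : injective t.
  move=> [i l] [j m]; rewrite /t/= => h.
  have ij : i = j.
    apply/eqP; apply/negP => /negP ij.
    have /eqP := bq _ _ (l%:Z - m%:Z) ij; apply.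
    have -> : l%:Z - m%:Z = (l%:Z - N%:Z) + (N%:Z - m%:Z) by ring.
    rewrite expfzDr// mulrA h -mulrA -expfzDr//.
    by have -> : (m%:Z - N%:Z) + (N%:Z - m%:Z) = 0 by [ring]; rewrite mulr1.
  subst j; congr (_, _); apply/val_inj => /=; apply/eqP; apply/negP => /negP lm.
  have lm0 : l%:Z - m%:Z != 0 by apply: contraNneq lm; lia.
  have /eqP := qZ _ lm0; apply.
  have -> : l%:Z - m%:Z = (l%:Z - N%:Z) - (m%:Z - N%:Z) by ring.
  rewrite expfzDr// (mulfI (b0 i) h) -expfzDr// subrr//.
have t0 p : t p != 0 by rewrite mulf_neq0// expfz_neq0.
have t1 p : t p != 1 by exact: bq1.
(* Half the number of points is chosen as the exponent: it spends [N] on each index j, which is what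
   [window_monomial] absorbs. *)
have NI : (N * #|I| < #|{: I * 'I_(N.*2)}|)%N.
  by rewrite card_prod card_ord -muln2 mulnC ltn_pmul2l// muln2 -addnn -[ltnLHS]addn0
    ltn_add2l.
have := lagrange_partial_fractions _ _ t _ tinj t0 t1 NI.
pose W i := (- b i) ^+ N * q ^ (- tri N%:Z).
have W0 i : W i != 0 by rewrite mulf_neq0 ?expf_neq0 ?oppr_eq0// expfz_neq0.
have -> : \prod_p (1 - t p)^-1 = \prod_i (W i)^-1 * \prod_i (qp (b i) q N * qp (q / b i) q
  N)^-1.
  rewrite -(pair_bigA _ (fun i l => (1 - t (i, l))^-1))/= -big_split/=.
  apply: eq_bigr => i _;
    rewrite -invfM prodfV -(big_mkord xpredT (fun l => 1 - b i * q ^ (l%:Z - N%:Z))).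
  rewrite prod_window ?b0 -?addnn ?leq_addr// addnK; congr _^-1.
  by rewrite /W; ring.
move/(congr1 ( *%R (\prod_i W i))).
have WW : \prod_i W i * \prod_i (W i)^-1 = 1.
  by rewrite -big_split/= big1// => i _; rewrite mulfV.
rewrite mulrA WW mul1r => ->.
rewrite mulr_sumr -(pair_bigA _ (fun i l => \prod_i W i * (t (i, l) ^- (N * #|I|) / (1 - t
  (i, l)) *
   \prod_(j | j != (i, l)) (1 - t j / t (i, l))^-1)))/=.
apply: eq_bigr => i _; rewrite bsum_window big_mkord; apply: eq_bigr => m _.
have -> : absz (N%:Z + (m%:Z - N%:Z))%R = m by lia.
have mN : (m < N.*2)%N by [].
have -> : absz (N%:Z - (m%:Z - N%:Z))%R = (N.*2 - m)%N by lia.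
have -> : (absz (N%:Z - (m%:Z - N%:Z) - 1)%R) = (N.*2 - m.+1)%N by lia.
pose P j := (- (b j / b i)) ^+ m * q ^ (- tri m%:Z).
have -> : \prod_(j | j != (i, m)) (1 - t j / t (i, m))^-1 =
   (\prod_j (P j)^-1) * (qp q q m * qp q q (N.*2 - m.+1))^-1 *
   \prod_(j | j != i) (qp (q / (b j / b i)) q m * qp (b j / b i) q (N.*2 - m))^-1.
  have tt j l : t (j, l) / t (i, m) = b j / b i * q ^ (l%:Z - m%:Z).
    rewrite /t/= invfM.
    have -> : l%:Z - m%:Z = (l%:Z - N%:Z) - (m%:Z - N%:Z) by ring.
    by rewrite (expfzDr (l%:Z - N%:Z))// -invr_expz; ring.
  transitivity (\prod_(j : I) \prod_(l < N.*2 | (j, l) != (i, m)) (1 - b j / b i * q ^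
    (l%:Z - m%:Z))^-1).
    rewrite pair_big_dep/=; apply: eq_big => [[j l]//|[j l] _].
    by rewrite tt.
  rewrite (bigD1 i)//= (bigD1 i (P := xpredT))//=.
  have -> : \prod_(j | j != i) \prod_(l < N.*2 | (j, l) != (i, m))
       (1 - b j / b i * q ^ (l%:Z - m%:Z))^-1 =
    \prod_(j | j != i) (P j)^-1 * \prod_(j | j != i)
     (qp (q / (b j / b i)) q m * qp (b j / b i) q (N.*2 - m))^-1.
    rewrite -big_split/=; apply: eq_bigr => j ji.
    rewrite -invfM prodfV; congr _^-1.
    rewrite (eq_bigl xpredT) => [|l]; last by rewrite xpair_eqE (negbTE ji).
    rewrite -(big_mkord xpredT (fun l => 1 - b j / b i * q ^ (l%:Z - m%:Z))).
    by rewrite prod_window ?mulf_neq0 ?invr_neq0// 1?ltnW// mulrA.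
  have -> : \prod_(l < N.*2 | (i, l) != (i, m)) (1 - b i / b i * q ^ (l%:Z - m%:Z))^-1
     = (P i)^-1 * (qp q q m * qp q q (N.*2 - m.+1))^-1.
    rewrite -invfM prodfV; congr _^-1.
    under eq_bigr do rewrite mulfV// mul1r.
    rewrite (eq_bigl (fun l : 'I_(N.*2) => l != m :> nat)) => [|l]; last first.
      by rewrite xpair_eqE eqxx.
    rewrite -(big_mkord (fun l => l != m) (fun l => 1 - q ^ (l%:Z - m%:Z))).
    by rewrite prod_window_punctured// /P mulfV// mulrA.
  by ring.
have -> : \prod_j ((b i / b j) ^ (m%:Z - N%:Z) * tsgn q (m%:Z - N%:Z)) =
    \prod_j W j * t (i, m) ^- (N * #|I|) * \prod_j (P j)^-1.
  have -> : t (i, m) ^- (N * #|I|) = \prod_(j : I) t (i, m) ^- N.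
    by rewrite prodr_const exprVn -exprM.
  rewrite -!big_split/=; apply: eq_bigr => j _.
  by rewrite -window_monomial// mulrA.
by ring.
Qed.

End FinitePartialFractions.

(** * Bilateral sums *)

Lemma cvg_absz (C : numFieldType) (u : nat -> C) (l : C) (n : int) : u @ \oo --> l ->
  (fun N : nat => u (absz (N%:Z + n)%R)) @ \oo --> l.
Proof.
move=> ul; apply: cvg_comp ul => P [K _ KP].
by exists (K + absz n)%N => // N /= KN; apply: KP => /=; lia.
Qed.

Section BilateralSums.
Variable C : numFieldType.
Hypothesis gcC : geometrically_complete C.

Lemma bdominatedM (f g : int -> C) (B : C) :
  bdominated f -> (forall n, `|g n| <= B) -> bdominated (fun n => f n * g n).
Proof.
move=> [M [r [r01 fM]]] gB; have [r0 r1] := andP r01.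
exists (M * B), r; split=> // n; rewrite normrM mulrAC.
by apply: ler_pM.
Qed.

Lemma bdominatedZ (f : int -> C) (c : C) :
  bdominated f -> bdominated (fun n => c * f n).
Proof.
move=> fd; have := bdominatedM _ (fun=> c) `|c| fd (fun=> lexx _).
by under eq_fun do rewrite mulrC.
Qed.

Lemma bdominatedD (f g : int -> C) :
  bdominated f -> bdominated g -> bdominated (fun n => f n + g n).
Proof.
move=> [M [r [/andP[r0 r1] fM]]] [M' [r' [/andP[r'0 r'1] gM]]].
have M0 : 0 <= M by have := fM 0; rewrite mulr1; apply: le_trans.
have M'0 : 0 <= M' by have := gM 0; rewrite mulr1; apply: le_trans.
have rle (a b : C) : 0 <= b -> a <= 1 -> a <= a + b * (1 - a).
  by move=> b0 a1; rewrite lerDl mulr_ge0// subr_ge0.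
(* The rate is 1 - (1 - r)(1 - r'), which lies above both [r] and [r'] and below 1; it takes the
   place of a maximum. *)
exists (M + M'), (r + r' * (1 - r)); split=> [|n].
  rewrite (le_trans r0 (rle _ _ r'0 (ltW r1)))/=.
  have -> : r + r' * (1 - r) = 1 - (1 - r) * (1 - r') by ring.
  by rewrite ltrBlDr ltrDl mulr_gt0// subr_gt0.
have rn0 : 0 <= r + r' * (1 - r) by rewrite (le_trans r0 (rle _ _ r'0 (ltW r1))).
apply: le_trans (ler_normD _ _) _; rewrite mulrDl; apply: lerD.
  apply: le_trans (fM n) _; rewrite ler_wpM2l// lerXn2r//.
  exact: rle r'0 (ltW r1).
apply: le_trans (gM n) _; rewrite ler_wpM2l// lerXn2r//.
have -> : r + r' * (1 - r) = r' + r * (1 - r') by ring.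
exact: rle r0 (ltW r'1).
Qed.

Lemma bilateral_sumD (f g : int -> C) : bdominated f -> bdominated g ->
  bilateral_sum (fun n => f n + g n) = bilateral_sum f + bilateral_sum g.
Proof.
move=> fd gd; apply: (bilateral_sum_unique _ gcC); first exact: bdominatedD.
rewrite (_ : (fun N => _) = (fun N => bsum N f + bsum N g)).
  by apply: cvgD; apply: bsum_cvg.
apply/funext => N.
by rewrite /bsum -big_split; apply: eq_bigr => k _ /=; ring.
Qed.

Lemma bilateral_sumZ (f : int -> C) (c : C) : bdominated f ->
  bilateral_sum (fun n => c * f n) = c * bilateral_sum f.
Proof.
move=> fd; apply: (bilateral_sum_unique _ gcC); first exact: bdominatedZ.
rewrite (_ : (fun N => _) = (fun N => c * bsum N f)).
  by apply: cvgM; [exact: cvg_cst | exact: bsum_cvg].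
apply/funext => N.
by rewrite /bsum mulr_sumr; apply: eq_bigr => k _; rewrite mulrDr.
Qed.

End BilateralSums.

(** * Bounds for Jacobi weights and Lambert denominators *)

Section ThetaTerms.
Variable C : numFieldType.
Hypothesis gcC : geometrically_complete C.
Variable q : C.
Hypothesis q1 : `|q| < 1.
Hypothesis q0 : q != 0.

(** Consecutive terms have ratio a |q|^k, eventually below 1, so the sequence decreases past some
    [K]; the sum of the earlier terms serves as the bound. *)
Lemma gaussian_bounded (a : C) : 0 <= a ->
  exists2 M : C, 0 <= M & forall k, a ^+ k * `|q| ^+ 'C(k, 2) <= M.
Proof.
move=> a0; pose u k := a ^+ k * `|q| ^+ 'C(k, 2).
have u0 k : 0 <= u k by rewrite mulr_ge0 ?exprn_ge0.
have uS k : u k.+1 = u k * (a * `|q| ^+ k).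
  by rewrite /u exprS binS bin1 exprD; ring.
have [K _ HK] := geometric_eventually_lt _ gcC _ _ _ a0 (q01 _ _ q1) ltr01.
exists (\sum_(0 <= k < K.+1) u k); first exact: sumr_ge0.
have small k : (k < K.+1)%N -> u k <= \sum_(0 <= k < K.+1) u k.
  move=> kK; rewrite (big_cat_nat (leq0n k) (ltnW kK))//= (big_ltn kK).
  by rewrite addrCA lerDl addr_ge0// sumr_ge0.
move=> k; rewrite -/(u k); have [/small//|Kk] := ltnP k K.+1.
rewrite -(subnK (ltnW Kk)); elim: (k - K)%N => [|m IH]; first exact: small.
apply: le_trans IH; rewrite addSn uS ler_piMr//; apply: ltW.
by apply: HK; rewrite /= leq_addl.
Qed.

(** For k >= 0, tri k = C(k,2) + k leaves a spare |q|^k. For n = -(k+1) the exponent is only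
    C(k+1,2), so the spare factor is borrowed by replacing 1/w with 1/(w q). *)
Lemma theta_term_dominated (w : C) : w != 0 ->
  exists2 M : C, 0 <= M & forall n, `|w ^ n * tsgn q n| <= M * `|q| ^+ absz n.
Proof.
move=> w0.
have [M1 M10 h1] := gaussian_bounded _ (normr_ge0 w).
have [M2 M20 h2] := gaussian_bounded _ (normr_ge0 (w * q)^-1).
exists (M1 + M2); first exact: addr_ge0.
have nq0 : `|q| != 0 by rewrite normr_eq0.
have triC k : tri (Posz k) = ('C(k, 2) + k)%N%:Z.
  elim: k => [|k IH]; first by apply: triE.
  by rewrite tri_natS IH binS bin1; lia.
move=> [k|k]; rewrite normrM /tsgn normrM.
  rewrite -exprnP normrX (_ : `|(-1) ^ k| = 1) ?mul1r; last first.
    by rewrite -exprnP normrX normrN1 expr1n.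
  rewrite triC -exprnP normrX exprD mulrA ler_wpM2r ?exprn_ge0//.
  by apply: le_trans (h1 k) _; rewrite lerDl.
rewrite !NegzE tri_opp triC -!exprnN.
rewrite normfV normrX (_ : `|(-1) ^- k.+1| = 1) ?mul1r; last first.
  by rewrite normfV normrX normrN1 expr1n invr1.
have -> : ('C(k.+1, 2) + k.+1)%N%:Z - k.+1%:Z = 'C(k.+1, 2)%:Z by lia.
rewrite -exprnP normrX abszN absz_nat.
have -> : `|w| ^- k.+1 * `|q| ^+ 'C(k.+1, 2) =
    (`|(w * q)^-1| ^+ k.+1 * `|q| ^+ 'C(k.+1, 2)) * `|q| ^+ k.+1.
  have := expf_neq0 k.+1 nq0; have : `|w| ^+ k.+1 != 0 by rewrite expf_neq0 ?normr_eq0.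
  rewrite normfV normrM exprVn exprMn.
  by set A := `|w| ^+ _; set B := `|q| ^+ k.+1 => A0 B0; field; apply/andP.
rewrite ler_wpM2r ?exprn_ge0//.
by apply: le_trans (h2 k.+1) _; rewrite lerDr.
Qed.

(** For n >= 0 the denominators tend to 1. Negative n reduce to this case by 1 / (1 - z/Q) = - (Q/z)
    / (1 - Q/z), with z^-1 in place of z. *)
Lemma lambert_denominator_bounded (z : C) : z != 0 ->
  (forall n : int, z * q ^ n != 1) ->
  exists2 B : C, 0 < B & forall n : int, `|(1 - z * q ^ n)^-1| <= B.
Proof.
move=> z0 zq.
have bnd (x : C) : (forall k, x * q ^+ k != 1) ->
    exists2 B : C, 0 < B & forall k, `|(1 - x * q ^+ k)^-1| <= B.
  move=> xq; apply: (cvgn_bounded _ _ 1); rewrite -[X in _ --> X]invr1.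
  apply: cvgV; first exact: oner_neq0.
  rewrite -[X in _ --> X]subr0 -(mulr0 x); apply: cvgB; first exact: cvg_cst.
  by apply: cvgM; [exact: cvg_cst | exact: gcC.1].
have [B1 B10 h1] := bnd z (fun k => zq (Posz k)).
have zq' k : z^-1 * q ^+ k != 1.
  apply: contra (zq (- k%:Z)) => /eqP h; rewrite -exprnN.
  by rewrite -(invrK z) -invfM h invr1.
have [B2 B20 h2] := bnd _ zq'.
exists (B1 + B2 * `|z^-1|); first by rewrite ltr_wpDr// mulr_ge0// ltW.
move=> [k|k].
  by apply: le_trans (h1 k) _; rewrite lerDl mulr_ge0// ltW.
rewrite NegzE -exprnN.
have -> : (1 - z / q ^+ k.+1)^-1 = - ((1 - z^-1 * q ^+ k.+1)^-1 * z^-1 * q ^+ k.+1).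
  have := zq' k.+1; set Q := q ^+ k.+1 => h.
  have Q0 : Q != 0 by rewrite expf_neq0.
have zQ : z != Q by apply: contraNneq h => <-; rewrite mulVf.
  by field; rewrite z0 Q0 !subr_eq0 zQ eq_sym zQ.
rewrite normrN 2!normrM; apply: le_trans (_ : B2 * `|z^-1| <= _); last by rewrite lerDr ltW.
rewrite -[leRHS]mulr1; apply: ler_pM => //; rewrite ?mulr_ge0//; last first.
  by rewrite normrX exprn_ile1// ltW.
by apply: ler_wpM2r.
Qed.

End ThetaTerms.

(** * Partial fractions of theta quotients *)

Section PartialFractions.
Variable C : numFieldType.
Hypothesis gcC : geometrically_complete C.
Variable q : C.
Hypothesis q1 : `|q| < 1.
Hypothesis q0 : q != 0.

Lemma expz_neq1 (n : int) : n != 0 -> q ^ n != 1.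
Proof.
have nat_case (k : nat) : q ^+ k.+1 != 1.
  apply/negP => /eqP h; have : `|q| ^+ k.+1 < 1 by rewrite exprn_ilt1.
  by rewrite -normrX h normr1 ltxx.
case: n => [[|k]|k] // _; first exact: nat_case.
by rewrite NegzE -exprnN invr_eq1.
Qed.

Variables (I : finType) (b : I -> C).
Hypothesis qZ : forall n : int, n != 0 -> q ^ n != 1.
Hypothesis b0 : forall i, b i != 0.
Hypothesis bq1 : forall i (n : int), b i * q ^ n != 1.
Hypothesis bq : forall i j (n : int), i != j -> b i * q ^ n != b j.

Let coef i (n : int) := \prod_j ((b i / b j) ^ n * tsgn q n) / (1 - b i * q ^ n).

Lemma lambert_coef_bound i : (0 < #|I|)%N ->
  exists2 M, 0 <= M & forall n, `|coef i n| <= M * `|q| ^+ absz n.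
Proof.
move=> I0; have [B B0 HB] := lambert_denominator_bounded _ gcC _ q1 q0 _ (b0 i) (bq1 i).
have bij j : b i / b j != 0 by rewrite mulf_neq0 ?invr_neq0.
have /choice[M HM] : forall j, exists M, 0 <= M /\
    forall n, `|(b i / b j) ^ n * tsgn q n| <= M * `|q| ^+ absz n.
  by move=> j; have [M ? ?] := theta_term_dominated _ gcC _ q1 q0 _ (bij j); exists M.
exists (\prod_j M j * B); first by rewrite mulr_ge0 ?(ltW B0)// prodr_ge0// => j _;
  have [] := HM j.
move=> n; rewrite /coef normrM [leRHS]mulrAC; apply: ler_pM => //.
rewrite normr_prod; apply: le_trans (_ : \prod_j (M j * `|q| ^+ absz n) <= _).
  by apply: ler_prod => j _; rewrite normr_ge0/=; have [] := HM j.
rewrite big_split/= ler_wpM2l//; first by rewrite prodr_ge0// => j _; have [] := HM j.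
(* Every index supplies a factor [|q| ^+ absz n]; one of them is kept and the others are bounded by
   1. *)
rewrite prodr_const -exprM -(prednK I0) mulnS exprD ler_piMr ?exprn_ge0//.
by rewrite exprn_ile1// ltW.
Qed.

(** The square of [qpoch q q] is the limit of the two products [qp q q] left over from the window of
    the index i itself, where the vanishing factor is omitted. *)
Lemma theta_partial_fractions : (0 < #|I|)%N ->
  qpoch q q ^+ 2 / \prod_i qtheta (b i) q =
  \sum_i bilateral_sum (coef i) / \prod_(j | j != i) qtheta (b j / b i) q.
Proof.
move=> I0.
have q_ok (z : C) : (forall n : int, z * q ^ n != 1) -> forall k, z * q ^+ k != 1.
  by move=> zq k; exact: (zq (Posz k)).
have q_inv_ok (z : C) : z != 0 -> (forall n : int, z * q ^ n != 1) ->
    forall k, q / z * q ^+ k != 1.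
  move=> z0 zq k; apply: contra (zq (- k.+1%:Z)) => /eqP h.
  by rewrite -exprnN exprS; move: h; rewrite mulrAC => h;
    rewrite -[z]invrK -invfM mulrC h invr1.
have qq k : q * q ^+ k != 1 by rewrite -exprS; apply: (qZ k.+1%:Z).
have bb i j : j != i -> forall n : int, b j / b i * q ^ n != 1.
  move=> ji n; apply: contra (bq _ _ n ji) => /eqP h.
  by rewrite -[b i]mul1r -h mulrAC divfK.
have bij i j : b j / b i != 0 by rewrite mulf_neq0 ?invr_neq0.
pose E := qpoch q q.
have E0 : E != 0 by exact: qpoch_neq0.
pose T N i (n : int) := coef i n
    * (qp q q (absz (N%:Z + n)%R) * qp q q (absz (N%:Z - n - 1)%R))^-1
    * \prod_(j | j != i) (qp (q / (b j / b i)) q (absz (N%:Z + n)%R)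
                          * qp (b j / b i) q (absz (N%:Z - n)%R))^-1.
have T_cvg i n : (T ^~ i ^~ n) @ \oo --> coef i n * (E * E)^-1
    * \prod_(j | j != i) (qtheta (b j / b i) q)^-1.
  apply: cvgM; first apply: cvgM; first exact: cvg_cst.
    apply: cvgV; first by rewrite mulf_neq0.
    rewrite /E; apply: cvgM; first by apply: (cvg_absz _ (qp q q) _ n); apply: qp_cvg.
    under eq_fun do rewrite -addrA.
    by apply: (cvg_absz _ (qp q q) _ (- n - 1)); apply: qp_cvg.
  apply: cvgn_prod => j ji; apply: cvgV; first by apply: qtheta_neq0 => //; apply: bb.
  rewrite /qtheta [X in _ --> X]mulrC.
  apply: cvgM; first by apply: (cvg_absz _ (qp _ q) _ n); apply: qp_cvg.
  by apply: (cvg_absz _ (qp _ q) _ (- n)); apply: qp_cvg.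
have T_bound i : exists M, forall N n, `|T N i n| <= M * `|q| ^+ absz n.
  have [M M0 HM] := lambert_coef_bound i I0.
  have [B B0 HB] := qpV_bounded _ gcC _ q1 _ qq.
  (* At j = i the quotient is 1 and some factors vanish, so nothing is claimed there and 0 is a
     dummy value. *)
  have /choice[D HD] : forall j, exists D : C, j != i -> 0 <= D /\ forall m k,
     `|(qp (q / (b j / b i)) q m * qp (b j / b i) q k)^-1| <= D.
    move=> j; have [->|ji] := eqVneq j i; first by exists 0.
    have [D1 D10 H1] := qpV_bounded _ gcC _ q1 _ (q_ok _ (bb _ _ ji)).
    have [D2 D20 H2] := qpV_bounded _ gcC _ q1 _ (q_inv_ok _ (bij i j) (bb _ _ ji)).
    exists (D2 * D1) => _; split=> [|m k]; first by rewrite mulr_ge0// ltW.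
    by rewrite invfM normrM; apply: ler_pM.
  exists (M * (B * B) * \prod_(j | j != i) D j) => N n.
  rewrite /T 2!normrM -!(mulrAC _ (`|q| ^+ _)); apply: ler_pM; rewrite ?mulr_ge0//.
    apply: ler_pM => //.
    by rewrite invfM normrM; apply: ler_pM.
  rewrite normr_prod; apply: ler_prod => j ji; rewrite normr_ge0/=.
  by have [_] := HD j ji.
have R_cvg : (fun N => \sum_i bsum N (T N i)) @ \oo -->
    \sum_i bilateral_sum (fun n => coef i n * (E * E)^-1
      * \prod_(j | j != i) (qtheta (b j / b i) q)^-1).
  apply: cvgn_sum => i _.
  have [M HM] := T_bound i.
  exact: (bsum_tannery _ gcC (fun N => T N i) _ M `|q| (q01 _ _ q1) HM (T_cvg i)).
have L_cvg : (fun N => \prod_i (qp (b i) q N * qp (q / b i) q N)^-1) @ \oo -->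
    \prod_i (qtheta (b i) q)^-1.
  apply: cvgn_prod => i _; apply: cvgV; first by apply: qtheta_neq0 => //.
  by apply: cvgM; apply: qp_cvg.
have {}R_cvg : (fun N => \prod_i (qp (b i) q N * qp (q / b i) q N)^-1) @ \oo -->
    \sum_i bilateral_sum (fun n => coef i n * (E * E)^-1
      * \prod_(j | j != i) (qtheta (b j / b i) q)^-1).
  apply: cvg_trans R_cvg; apply: near_eq_cvg; near=> N.
  rewrite theta_partial_fractions_finite//.
  by near: N; exists 1%N.
have := cvg_unique _ L_cvg R_cvg => /(_ (@norm_hausdorff _ C)) h.
rewrite -prodfV h mulr_sumr; apply: eq_bigr => i _.
have cd : bdominated (coef i).
  have [M M0 HM] := lambert_coef_bound i I0.
  by exists M, `|q|; split=> //; apply: q01.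
rewrite -prodfV.
under [X in bilateral_sum X]eq_fun do rewrite -mulrA mulrC.
rewrite bilateral_sumZ//; set A := bilateral_sum _; set D := \prod_(_ | _) _.
by rewrite -/E; field.
Unshelve. all: by end_near.
Qed.

End PartialFractions.

(** * Partial fractions in terms of [Sigmaz] with modulus 9 *)

Lemma bilateral_sum_flip (C : numFieldType) (f : int -> C) :
  bilateral_sum (fun n => f (- n - 1)) = bilateral_sum f.
Proof.
rewrite /bilateral_sum addrC; congr (limn _ + limn _); apply/funext => N;
  apply: eq_bigr => k _; congr f; lia.
Qed.

Section LambertSeries.
Variable C : numFieldType.
Hypothesis gcC : geometrically_complete C.
Variable q : C.
Hypothesis q1 : `|q| < 1.
Hypothesis q0 : q != 0.

Let q9_lt1 : `|q ^+ 9| < 1. Proof. by rewrite normrX exprn_ilt1. Qed.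
Let q9_neq0 : q ^+ 9 != 0. Proof. by rewrite expf_neq0. Qed.

Lemma exp9_neq1 (a n : int) : ~~ (9 %| a)%Z -> q ^ a * (q ^+ 9) ^ n != 1.
Proof.
move=> a9; rewrite exprnP exprz_exp -expfzDr//; apply: expz_neq1 => //.
by apply: contra a9 => /eqP h; apply/dvdzP; exists (- n); lia.
Qed.

(** The sign disappears and 4 tri n = 2 n (n + 1): this ties [Sigma] to expansions with four
    parameters. *)
Lemma tsgn_exp4 (p : C) (n : int) : p != 0 -> tsgn p n ^+ 4 = p ^ (2 * n * (n + 1)).
Proof.
move=> p0; rewrite /tsgn exprMn.
have -> : ((-1 : C) ^ n) ^+ 4 = 1.
  by rewrite [LHS]exprnP exprz_exp mulrC -exprz_exp -exprnP -signr_odd expr0 exp1rz.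
by rewrite mul1r [LHS]exprnP exprz_exp -mulrA -tri_double; congr (_ ^ _); ring.
Qed.

(** One of the four Jacobi weights carries the linear exponent [b] and gives the decay; the other
    three are merely bounded. *)
Lemma Sigmaz_dominated (a b : int) : ~~ (9 %| a)%Z ->
  bdominated (fun n : int => (q ^+ 9) ^ (2 * n * (n + 1)) * (q ^ b) ^ n / (1 - q ^ a * (q
    ^+ 9) ^ n)).
Proof.
move=> a9.
have [B _ HB] := lambert_denominator_bounded _ gcC _ q9_lt1 q9_neq0 _
  (expfz_neq0 a q0) (fun n => exp9_neq1 a n a9).
apply: (bdominatedM _ _ _ B) => //.
have [M1 M10 H1] := theta_term_dominated _ gcC _ q9_lt1 q9_neq0 1 (oner_neq0 _).
have [M2 M20 H2] := theta_term_dominated _ gcC _ q9_lt1 q9_neq0 _ (expfz_neq0 b q0).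
have -> : (fun n : int => (q ^+ 9) ^ (2 * n * (n + 1)) * (q ^ b) ^ n) =
   (fun n => (q ^ b) ^ n * tsgn (q ^+ 9) n * (1 ^ n * tsgn (q ^+ 9) n) ^+ 3).
  by apply/funext => n; rewrite -tsgn_exp4// exp1rz; ring.
apply: (bdominatedM _ _ _ (M1 ^+ 3)); first by exists M2, `|q ^+ 9|; split=> //; exact: q01.
move=> n; rewrite normrX lerXn2r//.
by apply: le_trans (H1 n) _; rewrite ler_piMr// exprn_ile1// ltW.
Qed.

(** The substitution n -> -n-1 fixes n (n + 1), swaps the two halves of the sum and inverts q^a
    q^(9n) up to replacing a by 9 - a; then 1 / (1 - 1/Y) = - Y / (1 - Y). *)
Lemma Sigmaz_flip (a b : int) : ~~ (9 %| a)%Z ->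
  Sigmaz a b 9 q = - q ^ (9 - a - b) * Sigmaz (9 - a) (9 - b) 9 q.
Proof.
move=> a9; rewrite /Sigmaz /Sigma -[q ^ 9]/(q ^+ 9).
have a9' : ~~ (9 %| (9 - a))%Z by rewrite rpredBl// dvdzz.
rewrite -[LHS]bilateral_sum_flip -bilateral_sumZ//; last exact: Sigmaz_dominated.
congr bilateral_sum; apply/funext => n.
have -> : 2 * (- n - 1) * (- n - 1 + 1) = 2 * n * (n + 1) by ring.
have := exp9_neq1 _ n a9'; have := exp9_neq1 _ (- n - 1) a9.
have -> : q ^ a * (q ^+ 9) ^ (- n - 1) = (q ^ (9 - a) * (q ^+ 9) ^ n)^-1.
  rewrite invfM !invr_expz !exprnP !exprz_exp -!expfzDr//; congr (_ ^ _); ring.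
have -> : (q ^ b) ^ (- n - 1) = q ^ (9 - a - b) * (q ^ (9 - b)) ^ n * (q ^ (9 - a) * (q ^+
  9) ^ n)^-1.
  rewrite invfM !invr_expz !exprnP !exprz_exp -!expfzDr//; congr (_ ^ _); ring.
set Y := q ^ (9 - a) * (q ^+ 9) ^ n.
have Y0 : Y != 0 by rewrite mulf_neq0// !expfz_neq0.
move=> h1 h2; field; rewrite Y0 !subr_eq0 h2 /=.
by rewrite eq_sym h2.
Qed.

Let T (a : int) := qtheta (q ^ a) (q ^+ 9).

Lemma lambert_coef4 (s : seq int) (x n : int) : size s = 4 ->
  \prod_(y <- s) ((q ^ x / q ^ y) ^ n * tsgn (q ^+ 9) n) =
  (q ^+ 9) ^ (2 * n * (n + 1)) * (q ^ (4 * x - \sum_(y <- s) y)) ^ n.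
Proof.
case: s => [|y1 [|y2 [|y3 [|y4 []]]]]// _.
rewrite !big_cons !big_nil !addr0 mulr1 -tsgn_exp4//.
have -> : (q ^ (4 * x - (y1 + (y2 + (y3 + y4))))) ^ n =
  (q ^ x / q ^ y1) ^ n * (q ^ x / q ^ y2) ^ n * (q ^ x / q ^ y3) ^ n * (q ^ x / q ^ y4) ^ n.
  rewrite !invr_expz -!expfzDr// !exprz_exp -!expfzDr//; congr (_ ^ _); ring.
by ring.
Qed.

Lemma sum_prod_ord4 (A : nat -> C) (B : nat -> nat -> C) :
  \sum_(i < 4) A i / \prod_(j < 4 | j != i) B i j =
  A 0%N / (B 0%N 1%N * B 0%N 2%N * B 0%N 3%N) + A 1%N / (B 1%N 0%N * B 1%N 2%N * B 1%N 3%N)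
  + A 2%N / (B 2%N 0%N * B 2%N 1%N * B 2%N 3%N) + A 3%N / (B 3%N 0%N * B 3%N 1%N * B 3%N 2%N).
Proof.
rewrite !(big_ord_recl, big_ord0) addr0 !addrA.
by do !congr (_ + _); congr (_ / _);
  rewrite big_mkcond !(big_ord_recl, big_ord0) /= !mulr1 ?mul1r ?mulrA.
Qed.

(** The second arguments 4 x - s come from [lambert_coef4]. Keeping [s] as a variable and the side
    conditions boolean lets concrete instances be discharged by computation alone. *)
Lemma Sigmaz_partial_fractions (a b c d : int) (s : int) :
  s = a + b + c + d ->
  all (fun x => ~~ (9 %| x)%Z) [:: a; b; c; d; b - a; c - a; d - a; c - b; d - b; d - c] ->
  qpoch (q ^+ 9) (q ^+ 9) ^+ 2 / (T a * T b * T c * T d) =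
  Sigmaz a (4 * a - s) 9 q / (T (b - a) * T (c - a) * T (d - a))
  + Sigmaz b (4 * b - s) 9 q / (T (a - b) * T (c - b) * T (d - b))
  + Sigmaz c (4 * c - s) 9 q / (T (a - c) * T (b - c) * T (d - c))
  + Sigmaz d (4 * d - s) 9 q / (T (a - d) * T (b - d) * T (c - d)).
Proof.
move=> sE /= /and5P[a9 b9 c9 d9 /and5P[ba ca da cb /and3P[db dc _]]].
pose e (i : 'I_4) := nth 0 [:: a; b; c; d] i.
have sym x y : ~~ (9 %| x - y)%Z -> ~~ (9 %| y - x)%Z by rewrite -opprB rpredN.
have e9 i : ~~ (9 %| e i)%Z by case: i => [[|[|[|[|]]]] h].
have ee i j : i != j -> ~~ (9 %| e i - e j)%Z.
  (* Hiding the divisibility test behind an opaque [D] lets the case analysis on i and j match the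
     twelve facts directly. *)
  have [D DE] : exists D : int -> int -> bool, forall x y, D x y = ~~ (9 %| x - y)%Z.
    by exists (fun x y => ~~ (9 %| x - y)%Z).
  rewrite -!DE in ba ca da cb db dc *; have {}sym x y : D x y -> D y x.
    by rewrite !DE; apply: sym.
  have := (sym _ _ ba, sym _ _ ca, sym _ _ da, sym _ _ cb, sym _ _ db, sym _ _ dc).
  move=> [[[[[ab ac] ad] bc] bd] cd].
  rewrite /e; case: i => [[|[|[|[|i]]]] hi] //; case: j => [[|[|[|[|j]]]] hj] //.
have qZ n : n != 0 -> (q ^+ 9) ^ n != 1 by apply: expz_neq1.
have := theta_partial_fractions _ gcC _ q9_lt1 q9_neq0 _ (fun i => q ^ e i) qZ
  (fun i => expfz_neq0 _ q0) (fun i n => exp9_neq1 _ n (e9 i)).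
move=> /(_ _ _); rewrite card_ord => /(_ _ isT).
have H : forall (i j : 'I_4) (n : int), i != j -> q ^ e i * (q ^+ 9) ^ n != q ^ e j.
  move=> i j n ij; apply: contra (exp9_neq1 _ n (ee _ _ ij)) => /eqP h.
  by rewrite expfzDr// mulrAC h -invr_expz mulfV// expfz_neq0.
move=> /(_ H).
have SE i : bilateral_sum (fun n : int => \prod_j ((q ^ e i / q ^ e j) ^ n * tsgn (q ^+ 9) n)
   / (1 - q ^ e i * (q ^+ 9) ^ n)) = Sigmaz (e i) (4 * e i - s) 9 q.
  rewrite /Sigmaz /Sigma; congr bilateral_sum; apply/funext => n; congr (_ / _).
  have := lambert_coef4 [:: a; b; c; d] (e i) n erefl.
  by rewrite (big_nth 0) big_mkord !big_cons big_nil addr0 !addrA -sE.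
have TE i j : qtheta (q ^ e j / q ^ e i) (q ^+ 9) = T (e j - e i).
  by rewrite /T expfzDr// -invr_expz.
rewrite [X in _ = X -> _](eq_bigr (fun i => Sigmaz (e i) (4 * e i - s) 9 q
    / \prod_(j | j != i) T (e j - e i))) => [|i _]; last first.
  by congr (_ / _); [exact: SE | apply: eq_bigr => j _; exact: TE].
have := sum_prod_ord4 (fun i => Sigmaz ([:: a; b; c; d]`_i) (4 * [:: a; b; c; d]`_i - s) 9 q)
  (fun i j => T ([:: a; b; c; d]`_j - [:: a; b; c; d]`_i)).
move=> /= <- <-; congr (_ / _).
by rewrite !(big_ord_recl, big_ord0) /= mulr1 -!mulrA.
Qed.

End LambertSeries.

(** * The Jacobi triple product *)

Section InverseFactorials.
Variable C : numFieldType.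
Variable q : C.
Hypothesis q0 : q != 0.
Hypothesis qZ : forall n : int, n != 0 -> q ^ n != 1.

(** The convention 1/(q)_n = 0 for n < 0 makes [iqp_rec] valid at every integer, so Pascal rules and
    binomial sums have no boundary cases. *)
Definition iqp (n : int) : C := if n is Posz m then (qp q q m)^-1 else 0.

Arguments iqp n : simpl never.

Lemma iqp_nat (n : nat) : iqp n = (qp q q n)^-1. Proof. by []. Qed.

Lemma qqp_neq0 n : qp q q n != 0.
Proof. by apply: qp_neq0 => k; rewrite -exprS; apply: (qZ k.+1%:Z). Qed.

Lemma iqp_neg n : n < 0 -> iqp n = 0. Proof. by case: n. Qed.

Lemma iqp_rec n : (1 - q ^ n) * iqp n = iqp (n - 1).
Proof.
case: n => [[|n]|n]; rewrite ?mulr0//; first by rewrite expr0z subrr mul0r iqp_neg.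
have -> : n.+1%:Z - 1 = n by lia.
rewrite !iqp_nat qpS -exprS invfM mulrCA mulfV ?mulr1//.
by rewrite subr_eq0 eq_sym; apply: (qZ n.+1%:Z).
Qed.

Lemma tsgnS n : tsgn q (n + 1) = - tsgn q n * q ^ (n + 1).
Proof.
rewrite /tsgn expfzDr ?oppr_eq0 ?oner_eq0// expr1z.
have -> : tri (n + 1) = tri n + (n + 1).
  by rewrite triD mulr1 [tri 1](triE _ 1)// -addrA [1 + n]addrC.
by rewrite expfzDr//; ring.
Qed.

Lemma tsgnD m n : tsgn q (m + n) = tsgn q m * tsgn q n * (q ^ m) ^ n.
Proof.
rewrite /tsgn triD !expfzDr ?oppr_eq0 ?oner_eq0// exprz_exp; ring.
Qed.

(** The q-binomial theorem divided by (q)_m. The q-Pascal rule is the splitting 1 - q^(m+1) = (1 -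
    q^(m+1-j)) + q^(m+1-j) (1 - q^j); its second part, shifted by one, yields the factor - y
    q^(m+1). *)
Lemma qbinomial (y : C) (m : nat) :
  \sum_(0 <= j < m.+1) y ^+ j * tsgn q j * (iqp j * iqp (m%:Z - j%:Z)) =
  qp (y * q) q m * iqp m.
Proof.
elim: m => [|m IH].
  by rewrite big_nat1 subrr iqp_nat !qp0 /tsgn [tri _](triE _ 0)// !expr0z invr1 !mulr1.
have q1m : 1 - q ^+ m.+1 != 0 by rewrite subr_eq0 eq_sym; apply: (qZ m.+1%:Z).
apply: (mulfI q1m).
have -> : (1 - q ^+ m.+1) * (qp (y * q) q m.+1 * iqp m.+1)
    = (1 - (y * q) * q ^+ m) * (qp (y * q) q m * iqp m).
  rewrite qpS; have -> : iqp m = (1 - q ^+ m.+1) * iqp m.+1.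
    by rewrite [q ^+ _]exprnP iqp_rec; congr iqp; lia.
  by ring.
rewrite -IH mulr_sumr.
have split (j : nat) : (1 - q ^+ m.+1) * (y ^+ j * tsgn q j * (iqp j * iqp (m.+1%:Z - j%:Z)))
   = y ^+ j * tsgn q j * (iqp j * iqp (m%:Z - j%:Z)) +
     y ^+ j * tsgn q j * q ^ (m.+1%:Z - j%:Z) * (iqp (j%:Z - 1) * iqp (m.+1%:Z - j%:Z)).
  have -> : m%:Z - j%:Z = (m.+1%:Z - j%:Z) - 1 by lia.
  rewrite -!iqp_rec; have -> : q ^+ m.+1 = q ^ (m.+1%:Z - j%:Z) * q ^ j.
    by rewrite -expfzDr// subrK.
  by ring.
rewrite (eq_bigr _ (fun j _ => split j)) big_split/= big_nat_recr//=.
rewrite [X in _ * (_ * iqp X)](_ : _ = -1); last by lia.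
rewrite [iqp (-1)]iqp_neg// !mulr0 addr0.
rewrite [X in _ + X = _]big_nat_recl// [iqp (0%:Z - 1)]iqp_neg// mul0r mulr0 add0r.
rewrite mulrBl mul1r; congr (_ + _); rewrite mulr_sumr -sumrN; apply: eq_bigr => j _.
have -> : j.+1%:Z - 1 = j by lia.
have -> : m.+1%:Z - j.+1%:Z = m%:Z - j%:Z by lia.
have -> : j.+1%:Z = j%:Z + 1 by lia.
rewrite tsgnS exprS.
have -> : q ^+ m = q ^ (j%:Z + 1) * q ^ (m%:Z - j%:Z) * q^-1.
  by rewrite -exprN1 -!expfzDr// exprnP; congr (_ ^ _); ring.
by field.
Qed.

Lemma jacobi_finite (x : C) (N : nat) : x != 0 -> (0 < N)%N ->
  bsum N (fun n => (x / q) ^ n * tsgn q n *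
     (qp q q (absz (N%:Z + n)%R) * qp q q (absz (N%:Z - n - 1)%R))^-1)
  = qp x q N.-1 * qp (q / x) q N * (qp q q (N.*2.-1))^-1.
Proof.
move=> x0 N0; rewrite bsum_window.
(* The order 2N - 1 gives 2N terms, one for each index of the window, and the factor q^(-N)
   recentres them. *)
have := qbinomial (x / q * q ^- N) N.*2.-1.
rewrite (prednK (n := N.*2)) ?double_gt0//.
have -> : qp (x / q * q ^- N * q) q N.*2.-1 =
    (- x) ^+ N * q ^ (- tri N%:Z) * qp (q / x) q N * qp x q N.-1.
  have := prod_window _ _ q0 x N N.*2.-1 x0; have -> : (N.*2.-1 - N)%N = N.-1 by lia.
  move=> <-; last by lia.
  apply: eq_bigr => u _; congr (1 - _).
  rewrite expfzDr// -exprnN -exprnP; have := expf_neq0 N q0.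
  by set Q := q ^+ N => Q0; field; rewrite Q0.
pose K : C := (- x) ^+ N * q ^ (- tri N%:Z).
have K0 : K != 0 by rewrite mulf_neq0 ?expf_neq0 ?oppr_eq0// expfz_neq0.
move=> h; apply: (mulfI K0); rewrite iqp_nat in h.
transitivity ((- x) ^+ N * q ^ (- tri N) * qp (q / x) q N * qp x q N.-1 / qp q q N.*2.-1);
  last first.
  by rewrite /K; ring.
rewrite -h mulr_sumr big_nat [RHS]big_nat; apply: eq_bigr => j /andP[_ jN].
have -> : absz (N%:Z + (j%:Z - N%:Z))%R = j by lia.
have -> : absz (N%:Z - (j%:Z - N%:Z) - 1)%R = (N.*2.-1 - j)%N by lia.
have -> : N.*2.-1%:Z - j%:Z = (N.*2.-1 - j)%N by lia.
suff tE : (x / q * q ^- N) ^+ j * tsgn q j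
    = K * ((x / q) ^ (j%:Z - N%:Z) * tsgn q (j%:Z - N%:Z)).
  by rewrite !iqp_nat tE invfM -!mulrA.
have jE : j%:Z = (j%:Z - N%:Z) + N%:Z by rewrite subrK.
move: jE; rewrite exprnP; set n := j%:Z - N%:Z; set a := x / q * q ^- N => ->.
have a0 : a != 0 by rewrite !mulf_neq0 ?invr_neq0 ?expf_neq0.
rewrite tsgnD expfzDr// {1}/a expfzMl.
have e1 : (q ^- N) ^ n * (q ^ n) ^ N = 1.
  by rewrite exprnN !exprz_exp -expfzDr// mulNr mulrC addNr.
have e2 : a ^ N * tsgn q N = K.
  rewrite /a /tsgn /K !expfzMl -exprN1 exprnN !exprz_exp -[- x]mulN1r exprMn -(exprnP x)
    -(exprnP (-1)).
  have -> : - tri N = -1 * N%:Z - N%:Z * N%:Z + tri N.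
    by apply: (mulIf (x := 2)) => //; rewrite [LHS]mulNr [RHS]mulrDl !tri_double; ring.
  rewrite !expfzDr// [- N%:Z * N%:Z]mulNr.
  by move: (q ^ (- 1 * N%:Z)) (q ^ (- (N%:Z * N%:Z))) (q ^ tri N) => A B D; ring.
rewrite -e2; move: e1.
set X1 := (x / q) ^ n; set X2 := (q ^- N) ^ n; set X3 := (q ^ n) ^ N => e1.
set X4 := a ^ N; set X5 := tsgn q n; set X6 := tsgn q N.
transitivity (X1 * X5 * (X2 * X3) * (X4 * X6)); first by ring.
by rewrite e1 mulr1; ring.
Qed.

End InverseFactorials.
Arguments iqp {C}.

(** * Splitting modulo 3, and the limit form of the triple product *)

Section Trisection.
Variable C : numFieldType.
Hypothesis gcC : geometrically_complete C.

Lemma bdominated_trisect (f : int -> C) (j : nat) : (j < 3)%N -> bdominated f ->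
  bdominated (fun n => f (3 * n + j%:Z)).
Proof.
move=> j3 [M [r [r01 fM]]]; have [r0 r1] := andP r01.
have M0 : 0 <= M by have := fM 0; rewrite mulr1; apply: le_trans.
exists M, r; split=> // n; apply: le_trans (fM _) _; rewrite ler_wpM2l//.
by apply: ler_wiXn2l => //; [exact: ltW | lia].
Qed.

(** The window -3N <= m < 3N is exactly the disjoint union of the images of -N <= n < N under 3n, 3n
    + 1 and 3n + 2, so the splitting is already exact for [bsum]. *)
Lemma bilateral_sum_trisect (f : int -> C) : bdominated f ->
  bilateral_sum f = bilateral_sum (fun n => f (3 * n))
    + bilateral_sum (fun n => f (3 * n + 1)) + bilateral_sum (fun n => f (3 * n + 2)).
Proof.
move=> fd; apply: (bilateral_sum_unique _ gcC _ _ fd).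
pose g (j : nat) n := f (3 * n + j%:Z).
have gE : (fun n => f (3 * n)) = g 0%N.
  by apply/funext => n; rewrite /g addr0.
have bE N : bsum (3 * N) f = bsum N (g 0%N) + bsum N (g 1%N) + bsum N (g 2%N).
  elim: N => [|N IH]; first by rewrite /bsum muln0 !big_nil !addr0.
  have -> : (3 * N.+1 = (3 * N).+3)%N by lia.
  rewrite /bsum !big_nat_recr//= -!/(bsum _ _) IH.
  have e0 : g 0%N N = f (3 * N)%N by rewrite /g; congr f; lia.
  have e1 : g 1%N N = f (3 * N).+1%N by rewrite /g; congr f; lia.
  have e2 : g 2%N N = f (3 * N).+2%N by rewrite /g; congr f; lia.
  have e3 : g 0%N (Negz N) = f (Negz (3 * N).+2) by rewrite /g; congr f; lia.
  have e4 : g 1%N (Negz N) = f (Negz (3 * N).+1) by rewrite /g; congr f; lia.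
  have e5 : g 2%N (Negz N) = f (Negz (3 * N)) by rewrite /g; congr f; lia.
  by rewrite e0 e1 e2 e3 e4 e5; ring.
rewrite gE.
have h : (fun N => bsum (3 * N) f) @ \oo -->
    bilateral_sum (g 0%N) + bilateral_sum (g 1%N) + bilateral_sum (g 2%N).
  rewrite (_ : (fun N => _) = (fun N => bsum N (g 0%N) + bsum N (g 1%N) + bsum N (g 2%N))).
    by apply: cvgD; first apply: cvgD; apply: bsum_cvg => //; apply: bdominated_trisect.
  exact/funext.
have h' : (fun N => bsum (3 * N) f) @ \oo --> bilateral_sum f.
  apply: (cvg_subseq _ (fun N => bsum N f) _ (muln 3)); first by move=> n; lia.
  exact: bsum_cvg.
by rewrite -(cvg_unique (@norm_hausdorff _ C) h' h); apply: bsum_cvg.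
Qed.

Variable q : C.
Hypothesis q1 : `|q| < 1.
Hypothesis q0 : q != 0.

Lemma qp_trisect (z : C) N :
  qp z q (3 * N) = qp z (q ^+ 3) N * qp (z * q) (q ^+ 3) N * qp (z * q ^+ 2) (q ^+ 3) N.
Proof.
elim: N => [|N IH]; first by rewrite muln0 !qp0 !mulr1.
have -> : (3 * N.+1 = (3 * N).+3)%N by lia.
rewrite !qpS IH -exprM !exprS; ring.
Qed.

Lemma qpoch_trisect (z : C) :
  qpoch z q = qpoch z (q ^+ 3) * qpoch (z * q) (q ^+ 3) * qpoch (z * q ^+ 2) (q ^+ 3).
Proof.
have q31 : `|q ^+ 3| < 1 by rewrite normrX exprn_ilt1.
have h : (fun N => qp z q (3 * N)) @ \oo --> qpoch z q.
  apply: (cvg_subseq _ (fun N => qp z q N) _ (muln 3)); first by move=> n; lia.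
  exact: qp_cvg.
have h' : (fun N => qp z q (3 * N)) @ \oo -->
    qpoch z (q ^+ 3) * qpoch (z * q) (q ^+ 3) * qpoch (z * q ^+ 2) (q ^+ 3).
  under eq_fun do rewrite qp_trisect.
  by apply: cvgM; first apply: cvgM; apply: qp_cvg.
exact: (cvg_unique (@norm_hausdorff _ C) h h').
Qed.

Lemma qtheta_trisect (z : C) : z != 0 ->
  qtheta z q = qtheta z (q ^+ 3) * qtheta (z * q) (q ^+ 3) * qtheta (z * q ^+ 2) (q ^+ 3).
Proof.
move=> z0; rewrite /qtheta !(qpoch_trisect z) !(qpoch_trisect (q / z)).
have -> : q ^+ 3 / (z * q) = q / z * q by field; rewrite z0 q0.
have -> : q ^+ 3 / (z * q ^+ 2) = q / z by field; rewrite z0 q0.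
have -> : q / z * q ^+ 2 = q ^+ 3 / z by field.
ring.
Qed.

(** The usual weight (-1)^n x^n q^(n(n-1)/2); since [tri] is n(n+1)/2, the base of the power is
    [x / q]. *)
Lemma jacobi_triple_product (x : C) : x != 0 ->
  (forall n : int, x * q ^ n != 1) ->
  qpoch q q * qtheta x q = bilateral_sum (fun n => (x / q) ^ n * tsgn q n).
Proof.
move=> x0 xq; have qZ := expz_neq1 _ _ q1.
have qq k : q * q ^+ k != 1 by rewrite -exprS; apply: (qZ k.+1%:Z).
pose E := qpoch q q; have E0 : E != 0 by exact: qpoch_neq0.
have y0 : x / q != 0 by rewrite mulf_neq0// invr_neq0.
have [M M0 HM] := theta_term_dominated _ gcC _ q1 q0 _ y0.
have [B B0 HB] := qpV_bounded _ gcC _ q1 _ qq.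
have fd : bdominated (fun n => (x / q) ^ n * tsgn q n).
  by exists M, `|q|; split=> //; apply: q01.
pose T N n := (x / q) ^ n * tsgn q n *
     (qp q q (absz (N%:Z + n)%R) * qp q q (absz (N%:Z - n - 1)%R))^-1.
have T_cvg n : (T ^~ n) @ \oo --> (x / q) ^ n * tsgn q n * (E * E)^-1.
  apply: cvgM; first exact: cvg_cst.
  apply: cvgV; first by rewrite mulf_neq0.
  rewrite /E; apply: cvgM; first by apply: (cvg_absz _ (qp q q) _ n); apply: qp_cvg.
  under eq_fun do rewrite -addrA.
  by apply: (cvg_absz _ (qp q q) _ (- n - 1)); apply: qp_cvg.
have R_cvg : (fun N => bsum N (T N)) @ \oo -->
    bilateral_sum (fun n => (x / q) ^ n * tsgn q n * (E * E)^-1).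
  apply: (bsum_tannery _ gcC T _ (M * (B * B)) `|q| (q01 _ _ q1)) => // N n.
  rewrite /T normrM mulrAC; apply: ler_pM => //.
  by rewrite invfM normrM; apply: ler_pM.
have L_cvg : (fun N => qp x q N.-1 * qp (q / x) q N * (qp q q (N.*2.-1))^-1) @ \oo -->
    qtheta x q * E^-1.
  apply: cvgM; last first.
    rewrite -(cvg_shiftS (fun N => (qp q q N.*2.-1)^-1)) /=.
    apply: (cvg_subseq _ (fun N => (qp q q N)^-1) _ (fun N => N.+1.*2.-1)).
      by move=> n; lia.
    exact: qpV_cvg.
  apply: cvgM; last exact: qp_cvg.
  rewrite -(cvg_shiftS (fun N => qp x q N.-1)) /=; exact: qp_cvg.
have {}R_cvg : (fun N => qp x q N.-1 * qp (q / x) q N * (qp q q (N.*2.-1))^-1) @ \oo -->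
    bilateral_sum (fun n => (x / q) ^ n * tsgn q n * (E * E)^-1).
  apply: cvg_trans R_cvg; apply: near_eq_cvg; near=> N.
  rewrite /T -jacobi_finite//.
  by near: N; exists 1%N.
have := cvg_unique (@norm_hausdorff _ C) L_cvg R_cvg.
have -> : bilateral_sum (fun n => (x / q) ^ n * tsgn q n * (E * E)^-1) =
    (E * E)^-1 * bilateral_sum (fun n => (x / q) ^ n * tsgn q n).
  by rewrite -bilateral_sumZ//; congr bilateral_sum; apply/funext => n; rewrite mulrC.
set S := bilateral_sum _ => h.
have -> : S = E * E * ((E * E)^-1 * S) by field.
by rewrite -h -/E; field.
Unshelve. all: by end_near.
Qed.

End Trisection.

(** * Trisection of Euler's product *)

Section Euler.
Variable C : numFieldType.
Hypothesis gcC : geometrically_complete C.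
Variable q : C.
Hypothesis q1 : `|q| < 1.
Hypothesis q0 : q != 0.

Let p := q ^+ 27.

(** Since (q)_oo = (q^3; q^3)_oo [q; q^3]_oo, the triple product in base q^3 expands it as the
    pentagonal series. Each class of n modulo 3 is again a triple product, in base q^27. *)
Lemma euler_trisection :
  qpoch q q = qpoch p p * (qtheta (q ^+ 12) p - q * qtheta (q ^+ 6) p - q ^+ 2 * qtheta (q
    ^+ 3) p).
Proof.
have qZ := expz_neq1 _ _ q1.
have q31 : `|q ^+ 3| < 1 by rewrite normrX exprn_ilt1.
have q30 : q ^+ 3 != 0 by rewrite expf_neq0.
have p1 : `|p| < 1 by rewrite normrX exprn_ilt1.
have p0 : p != 0 by rewrite expf_neq0.
have ok (k : nat) : (k %% 27 != 0)%N -> forall n : int, q ^+ k * p ^ n != 1.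
  move=> k27 n; rewrite /p !exprnP exprz_exp -expfzDr//; apply: qZ; lia.
have -> : qpoch q q = qpoch (q ^+ 3) (q ^+ 3) * qtheta q (q ^+ 3).
  rewrite [LHS]qpoch_trisect// /qtheta.
  have -> : q * q = q ^+ 3 / q by field.
  have -> : q * q ^+ 2 = q ^+ 3 by ring.
  ring.
rewrite jacobi_triple_product//; last first.
  move=> n; rewrite [_ ^+ 3]exprnP exprz_exp -{1}(expr1z q) -expfzDr//; apply: qZ; lia.
have y0 : q / q ^+ 3 != 0 by rewrite mulf_neq0// invr_neq0.
rewrite bilateral_sum_trisect//; last first.
  have [M _ HM] := theta_term_dominated _ gcC _ q31 q30 _ y0.
  by exists M, `|q ^+ 3|; split=> //; apply: q01.
(* The class j = 0, 1, 2 has prefactor exponent a = 0, 1, 5 and theta argument q^k with k = 12, 21,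
   30. *)
have term (j k : nat) (a : int) (n : int) :
  2 * a = 3 * (j%:Z * (j%:Z + 1)) - 4 * j%:Z -> k%:Z = 12 + 9 * j%:Z ->
  (q / q ^+ 3) ^ (3 * n + j%:Z) * tsgn (q ^+ 3) (3 * n + j%:Z) =
  (-1) ^ j%:Z * q ^ a * ((q ^+ k / p) ^ n * tsgn p n).
  move=> aE kE.
  have -> : q / q ^+ 3 = q ^ (-2) by rewrite -exprnN; field.
  have -> : q ^+ k / p = q ^ (k%:Z - 27) by rewrite expfzDr// -exprnN.
  rewrite /tsgn /p (exprnP q 3) (exprnP q 27) [(-1) ^ (3 * n + _)]expfzDr ?oppr_eq0
    ?oner_eq0//.
  have -> : (-1 : C) ^ (3 * n) = (-1) ^ n.
    by rewrite -exprz_exp; congr (_ ^ _); rewrite -exprnP; ring.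
  rewrite !exprz_exp.
  have e : q ^ (- 2 * (3 * n + j%:Z)) * q ^ (3%N%:Z * tri (3 * n + j%:Z)) =
      q ^ a * q ^ ((k%:Z - 27) * n) * q ^ (27%N%:Z * tri n).
    rewrite -!expfzDr//; congr (_ ^ _).
    apply: (mulIf (x := 2)) => //.
    have := tri_double (3 * n + j%:Z); have := tri_double n.
    rewrite kE; move: (tri n) (tri (3 * n + j%:Z)) => t1 t2 h1 h2.
    transitivity (- 4 * (3 * n + j%:Z) + 3 * (t2 * 2)); first by ring.
    transitivity (2 * a + 2 * ((12 + 9 * j%:Z - 27) * n) + 27 * (t1 * 2)); last by ring.
    by rewrite h1 h2 aE; ring.
  move: e; set e1 := q ^ _; set e2 := q ^ (_ * tri _); set e3 := q ^ _; set e4 := q ^ _.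
  set e5 := q ^ _; set s1 := (-1) ^ n; set s2 := (-1) ^ j => e.
  transitivity (s1 * s2 * (e1 * e2)); first by ring.
  by rewrite e; ring.
have pq (x : C) : x != 0 -> (forall n : int, x * p ^ n != 1) ->
    bilateral_sum (fun n => (x / p) ^ n * tsgn p n) = qpoch p p * qtheta x p.
  by move=> x0 xp; rewrite jacobi_triple_product.
have dom (x : C) : x != 0 -> bdominated (fun n => (x / p) ^ n * tsgn p n).
  move=> x0; have xp0 : x / p != 0 by rewrite mulf_neq0// invr_neq0.
  have [M _ HM] := theta_term_dominated _ gcC _ p1 p0 _ xp0.
  by exists M, `|p|; split=> //; apply: q01.
have T0 : bilateral_sum (fun n => (q / q ^+ 3) ^ (3 * n) * tsgn (q ^+ 3) (3 * n)) =
    qpoch p p * qtheta (q ^+ 12) p.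
  rewrite -pq ?expf_neq0//; last exact: ok.
  congr bilateral_sum; apply/funext => n.
  by have := term 0%N 12%N 0 n erefl erefl; rewrite addr0 !expr0z !mul1r.
have T1 : bilateral_sum (fun n => (q / q ^+ 3) ^ (3 * n + 1) * tsgn (q ^+ 3) (3 * n + 1)) =
    - (q * (qpoch p p * qtheta (q ^+ 6) p)).
  have -> : qtheta (q ^+ 6) p = qtheta (q ^+ 21) p.
    rewrite -[RHS]qtheta_sym ?expf_neq0//; congr qtheta; rewrite /p.
    by rewrite (_ : 27 = 21 + 6)%N// exprD mulrC mulKf// expf_neq0.
  rewrite -pq ?expf_neq0//; last exact: ok.
  rewrite -mulNr -bilateral_sumZ//; last by apply: dom; rewrite expf_neq0.
  congr bilateral_sum; apply/funext => n.
  by rewrite (term 1%N 21%N 1 n erefl erefl) !expr1z mulN1r.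
have T2 : bilateral_sum (fun n => (q / q ^+ 3) ^ (3 * n + 2) * tsgn (q ^+ 3) (3 * n + 2)) =
    - (q ^+ 2 * (qpoch p p * qtheta (q ^+ 3) p)).
  (* As 30 = 27 + 3, symmetry leads from q^30 to q^(-3), and inversion to q^3 at the cost of -
     q^(-3), which turns q^5 into - q^2. *)
  have -> : q ^+ 2 * (qpoch p p * qtheta (q ^+ 3) p) = - (q ^+ 5 * (qpoch p p * qtheta (q
    ^+ 30) p)).
    have -> : q ^+ 30 = p / (q ^+ 3)^-1 by rewrite invrK /p -exprD.
    rewrite qtheta_sym ?invr_neq0 ?expf_neq0// qtheta_inv ?expf_neq0//.
    by field.
  rewrite opprK -pq ?expf_neq0//; last exact: ok.
  rewrite -bilateral_sumZ//; last by apply: dom; rewrite expf_neq0.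
  congr bilateral_sum; apply/funext => n.
  by rewrite (term 2%N 30%N 5 n erefl erefl) -!exprnP sqrrN expr1n mul1r.
by rewrite T0 T1 T2; ring.
Qed.

End Euler.

(** * The Bailey pair *)

Section BsumLemmas.
Variable C : numFieldType.

Lemma bsum_telescope (G : int -> C) N :
  bsum N (fun i => G i - G (i + 1)) = G (- N%:Z) - G N.
Proof.
elim: N => [|N IH]; first by rewrite /bsum big_nil subrr.
move: IH; rewrite /bsum big_nat_recr//= => ->.
have -> : Negz N + 1 = - N%:Z by lia.
have -> : N%:Z + 1 = N.+1 by lia.
by rewrite -NegzE; ring.
Qed.

Lemma bsum_delta (f : int -> C) N : (0 < N)%N -> (forall n, n != 0 -> f n = 0) ->
  bsum N f = f 0.
Proof.
case: N => // N _ f0; rewrite /bsum big_nat_recl//= (f0 (Negz 0))// addr0.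
by rewrite big1 ?addr0// => k _; rewrite !f0// addr0.
Qed.

End BsumLemmas.

Section SchurSums.
Variable C : numFieldType.
Variable q : C.
Hypothesis q0 : q != 0.
Hypothesis qZ : forall n : int, n != 0 -> q ^ n != 1.

(** The Gaussian binomial coefficient, extended by 0 to all integers [k]. *)
Definition gbin (N : nat) (k : int) : C := qp q q N * (iqp q k * iqp q (N%:Z - k)).

Lemma gbin_pascal (N : nat) k : gbin N.+1 k = gbin N (k - 1) + q ^ k * gbin N k.
Proof.
rewrite /gbin qpS -exprS.
have -> : N%:Z - (k - 1) = N.+1%:Z - k by lia.
have -> : N%:Z - k = (N.+1%:Z - k) - 1 by lia.
rewrite -!iqp_rec//; have -> : q ^+ N.+1 = q ^ k * q ^ (N.+1%:Z - k).
  by rewrite -expfzDr// addrC subrK.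
ring.
Qed.

Lemma gbin_pascal' (N : nat) k :
  gbin N.+1 k = gbin N k + q ^ (N.+1%:Z - k) * gbin N (k - 1).
Proof.
rewrite /gbin qpS -exprS.
have -> : N%:Z - (k - 1) = N.+1%:Z - k by lia.
have -> : N%:Z - k = (N.+1%:Z - k) - 1 by lia.
rewrite -!iqp_rec//; have -> : q ^+ N.+1 = q ^ k * q ^ (N.+1%:Z - k).
  by rewrite -expfzDr// addrC subrK.
ring.
Qed.

Lemma gbin_out (N : nat) k : (k < 0) || (N%:Z < k) -> gbin N k = 0.
Proof.
move=> /orP[k0|Nk]; rewrite /gbin; first by rewrite iqp_neg// mul0r mulr0.
by rewrite (iqp_neg _ q (_ - _)) ?mulr0//; lia.
Qed.

Lemma gbin00 : gbin 0 0 = 1.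
Proof.
have iqp0 : iqp q 0 = 1 by rewrite -[0]/(Posz 0) iqp_nat qp0 invr1.
by rewrite /gbin subr0 qp0 iqp0 !mulr1.
Qed.

(** The terms k = 2i and k = 2i + 1 of the pentagonal series with exponents k(3k+1)/2 and signs
    (-1)^k, each weighted by a Gaussian binomial. *)
Definition schur_even (n : nat) (i : int) : C :=
  q ^ (6 * i * i + i) * (gbin n.*2 (n%:Z - 3 * i) - q ^ (6 * i + 2) * gbin n.*2 (n%:Z - 3 *
    i - 2)).
Definition schur_odd (n : nat) (i : int) : C :=
  q ^ (6 * i * i + i) * (gbin n.*2.+1 (n%:Z - 3 * i) - q ^ (6 * i + 2) * gbin n.*2.+1 (n%:Z
    - 3 * i - 1)).

(** A different Pascal rule for each of the two binomials: both produce [gbin n.*2 (n - 3 i - 1)]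
    with the same coefficient, and these cancel. *)
Lemma schur_odd_even n i : schur_odd n i = schur_even n i.
Proof.
rewrite /schur_odd /schur_even gbin_pascal' gbin_pascal; congr (_ * _).
have -> : n%:Z - 3 * i - 1 - 1 = n%:Z - 3 * i - 2 by ring.
have -> : q ^ (n.*2.+1%:Z - (n%:Z - 3 * i)) = q ^ (6 * i + 2) * q ^ (n%:Z - 3 * i - 1).
  by rewrite -expfzDr//; congr (_ ^ _); lia.
ring.
Qed.

(** With the Pascal rules exchanged the surplus terms no longer cancel at the same [i]; they have
    the form G i - G (i + 1), so they telescope in the sum. *)
Lemma schur_even_odd n i :
  schur_even n.+1 i = schur_odd n i +
   (q ^ (6 * i * i - 2 * i + n.+1%:Z) * gbin n.*2.+1 (n.+1%:Z - 3 * i) -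
    q ^ (6 * (i + 1) * (i + 1) - 2 * (i + 1) + n.+1%:Z) * gbin n.*2.+1 (n.+1%:Z - 3 * (i +
      1))).
Proof.
rewrite /schur_odd /schur_even doubleS [gbin n.*2.+2 (n.+1%:Z - 3 * i)]gbin_pascal [gbin
  n.*2.+2 _]gbin_pascal'.
have -> : n.+1%:Z - 3 * i - 1 = n%:Z - 3 * i by lia.
have -> : n.+1%:Z - 3 * i - 2 = n%:Z - 3 * i - 1 by lia.
have -> : n%:Z - 3 * i - 1 - 1 = n.+1%:Z - 3 * (i + 1) by lia.
have -> : q ^ (6 * i * i - 2 * i + n.+1%:Z) = q ^ (6 * i * i + i) * q ^ (n.+1%:Z - 3 * i).
  by rewrite -expfzDr//; congr (_ ^ _); ring.
have -> : q ^ (6 * (i + 1) * (i + 1) - 2 * (i + 1) + n.+1%:Z) =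
    q ^ (6 * i * i + i) * q ^ (6 * i + 2) * q ^ (n.*2.+2%:Z - (n%:Z - 3 * i - 1)).
  rewrite -!expfzDr//; congr (_ ^ _).
  by have -> : n.*2.+2%:Z = n%:Z + n%:Z + 2 by [lia]; have -> : n.+1%:Z = n%:Z + 1 by [lia];
    ring.
ring.
Qed.

Lemma bsum_eq N (f g : int -> C) : (forall n, f n = g n) -> bsum N f = bsum N g.
Proof. by move=> fg; apply: eq_bigr => k _; rewrite !fg. Qed.

Lemma bsum_add N (f g : int -> C) : bsum N (fun n => f n + g n) = bsum N f + bsum N g.
Proof. by rewrite /bsum -big_split; apply: eq_bigr => k _ /=; ring. Qed.

(** The condition [n <= M] puts the boundary binomials of the telescoping sum, at i = M and i = -M,
    out of range, so the sum keeps its value at n = 0, where only i = 0 survives. *)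
Lemma schur_even_sum (M n : nat) : (0 < M)%N -> (n <= M)%N -> bsum M (schur_even n) = 1.
Proof.
move=> M0; elim: n => [|n IH] nM.
  have gbin0 (k : int) : k != 0 -> gbin 0 k = 0.
    by move=> k0; rewrite gbin_out//; lia.
  rewrite bsum_delta//.
    rewrite /schur_even [X in q ^ X * _](_ : _ = 0)// expr0z mul1r.
    rewrite [gbin _ (_ - 2)]gbin_out// [X in gbin _ X](_ : _ = 0)//.
    by rewrite mulr0 subr0; exact: gbin00.
  by move=> i i0; rewrite /schur_even !gbin0 ?mulr0 ?subr0 ?mulr0//; lia.
rewrite (bsum_eq _ _ _ (schur_even_odd n)) bsum_add.
rewrite (bsum_eq _ _ _ (schur_odd_even n)) IH; last exact: ltnW.
rewrite (bsum_telescope _ (fun i => q ^ (6 * i * i - 2 * i + n.+1%:Z) * gbin n.*2.+1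
  (n.+1%:Z - 3 * i))).
by rewrite !gbin_out ?mulr0 ?subr0 ?addr0//; lia.
Qed.

Lemma schur_odd_sum (M n : nat) : (0 < M)%N -> (n <= M)%N -> bsum M (schur_odd n) = 1.
Proof. by move=> M0 nM; rewrite (bsum_eq _ _ _ (schur_odd_even n)) schur_even_sum. Qed.

(** Divide [schur_odd_sum] by (q)_(2n+1) and put the two binomials over a common denominator; with r
    = 3i + 1 the numerator is (1 - q^(n+1+r)) - q^(2r) (1 - q^(n+1-r)) = 1 - q^(2r). The index is
    that of beta_(n+1). *)
Lemma bailey_pair (M n : nat) : (n < M)%N ->
  iqp q n.*2.+1 = bsum M (fun i =>
    q ^ (6 * i * i + i) * (1 - q ^ (6 * i + 2)) *
    (iqp q (n.+1%:Z - (3 * i + 1)) * iqp q (n.+1%:Z + (3 * i + 1)))).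
Proof.
move=> nM; have := schur_odd_sum M n (leq_ltn_trans (leq0n n) nM) (ltnW nM).
move/(congr1 (fun x => iqp q n.*2.+1 * x)); rewrite mulr1 => <-.
rewrite /bsum mulr_sumr; apply: eq_bigr => k _; rewrite mulrDr.
have E i : iqp q n.*2.+1 * schur_odd n i = q ^ (6 * i * i + i) * (1 - q ^ (6 * i + 2)) *
    (iqp q (n.+1%:Z - (3 * i + 1)) * iqp q (n.+1%:Z + (3 * i + 1))).
  rewrite /schur_odd /gbin.
  have -> : n.*2.+1%:Z - (n%:Z - 3 * i) = (n.+1%:Z + (3 * i + 1)) - 1 by lia.
  have -> : n.*2.+1%:Z - (n%:Z - 3 * i - 1) = n.+1%:Z + (3 * i + 1) by lia.
  have -> : n%:Z - 3 * i = n.+1%:Z - (3 * i + 1) by lia.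
  rewrite -!iqp_rec//.
  have -> : q ^ (n.+1%:Z + (3 * i + 1)) = q ^ (6 * i + 2) * q ^ (n.+1%:Z - (3 * i + 1)).
    by rewrite -expfzDr//; congr (_ ^ _); ring.
  have : iqp q n.*2.+1 * qp q q n.*2.+1 = 1 by rewrite iqp_nat mulVf// qqp_neq0.
  set U := iqp q n.*2.+1; set V := qp _ _ _ => UV.
  set A := q ^ (6 * i * i + i); set B := q ^ (6 * i + 2); set D := q ^ _.
  set X := iqp q _; set Y := iqp q _.
  transitivity ((U * V) * (A * (1 - B) * (X * Y))); first by ring.
  by rewrite UV mul1r.
by rewrite !E.
Qed.

(** With X = q^(N+1) and Y = q^r the induction step is Y (1 - X/Y)(1 - X Y) + X (1 - z Y)(1 - Y/z) =
    Y (1 - z X)(1 - X/z). At N = 0 both sides vanish unless r = 0. *)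
Lemma bailey_telescope (z : C) (r : int) (N : nat) : z != 0 ->
  z * q ^ r != 1 -> z^-1 * q ^ r != 1 ->
  \sum_(0 <= n < N.+1) q ^+ n * qp z q n * qp z^-1 q n * (iqp q (n%:Z - r) * iqp q (n%:Z +
    r)) =
  qp z q N.+1 * qp z^-1 q N.+1 * (iqp q (N%:Z - r) * iqp q (N%:Z + r))
   * (q ^ r / ((1 - z * q ^ r) * (1 - z^-1 * q ^ r))).
Proof.
move=> z0 z1 z2; have Y0 : q ^ r != 0 by rewrite expfz_neq0.
elim: N => [|N IH].
  rewrite big_nat1 !qp0 !mulr1 mul1r !qpS !qp0 expr0 !mul1r !mulr1 sub0r add0r.
  have [r0|r0] := eqVneq r 0.
    move: z1; rewrite r0 expr0z !mulr1 => z1; field.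
    by rewrite z0 !subr_eq0 z1 eq_sym z1.
  have -> : iqp q (- r) * iqp q r = 0.
    have [rn|rn] : r < 0 \/ - r < 0 by lia.
      by rewrite (iqp_neg _ _ r rn) mulr0.
    by rewrite (iqp_neg _ _ _ rn) mul0r.
  by rewrite mulr0 mul0r.
rewrite big_nat_recr// IH.
have -> : N%:Z - r = (N.+1%:Z - r) - 1 by lia.
have -> : N%:Z + r = (N.+1%:Z + r) - 1 by lia.
rewrite -!iqp_rec// ![qp _ _ N.+2]qpS /=.
set X := q ^+ N.+1; rewrite (expfzDr N.+1%:Z (- r)) // (expfzDr N.+1%:Z r) // -invr_expz
  -exprnP -/X.
move: Y0 z1 z2; set Y := q ^ r => Y0 z1 z2.
set A := qp z q N.+1; set B := qp z^-1 q N.+1; set D := iqp q _; set E := iqp q _.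
have zY : z != Y by apply: contraNneq z2 => <-; rewrite mulVf.
by field; rewrite z0 Y0 !subr_eq0 zY eq_sym z1.
Qed.

End SchurSums.

Section BaileyLimit.
Variable C : numFieldType.
Hypothesis gcC : geometrically_complete C.
Variables q z : C.
Hypothesis q1 : `|q| < 1.
Hypothesis q0 : q != 0.
Hypothesis z0 : z != 0.
Hypothesis zq : forall n : int, z * q ^ n != 1.

Let qZ : forall n : int, n != 0 -> q ^ n != 1. Proof. exact: expz_neq1. Qed.

Let zq' (n : int) : z^-1 * q ^ n != 1.
Proof.
apply: contra (zq (- n)) => /eqP h; rewrite -invr_expz.
by rewrite -(invrK z) -invfM h invr1.
Qed.

Definition bailey_term (i : int) : C :=
  q ^ (6 * i * i + i) * (1 - q ^ (6 * i + 2))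
  * (q ^ (3 * i + 1) / ((1 - z * q ^ (3 * i + 1)) * (1 - z^-1 * q ^ (3 * i + 1)))).

(** The two Gaussian exponents are 6n^2 + 4n + 1 = 12 tri n - 2n + 1 and 6n^2 + 10n + 3 = 12 tri n +
    4n + 3, so both parts are Jacobi weights in base q^12; the minus signs in the bases cancel that
    of [tsgn]. *)
Lemma bailey_term_dominated : bdominated bailey_term.
Proof.
have q31 : `|q ^+ 3| < 1 by rewrite normrX exprn_ilt1.
have q30 : q ^+ 3 != 0 by rewrite expf_neq0.
have Q1 : `|q ^+ 12| < 1 by rewrite normrX exprn_ilt1.
have Q0 : q ^+ 12 != 0 by rewrite expf_neq0.
have cube (n : int) : q ^ (3 * n + 1) = q * (q ^+ 3) ^ n.
  by rewrite (exprnP q 3) exprz_exp expfzDr// expr1z mulrC.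
have den (x : C) : x != 0 -> (forall n : int, x * q ^ n != 1) ->
    exists2 B : C, 0 < B & forall n : int, `|(1 - x * q ^ (3 * n + 1))^-1| <= B.
  move=> x0 xq; have := lambert_denominator_bounded _ gcC _ q31 q30 (x * q).
  rewrite mulf_neq0// => /(_ isT)[n|B B0 HB].
    by rewrite -mulrA -cube.
  by exists B => // n; rewrite cube mulrA.
have [B1 B10 HB1] := den z z0 zq.
have zi0 : z^-1 != 0 by rewrite invr_neq0.
have [B2 B20 HB2] := den z^-1 zi0 zq'.
have dom (w : C) : w != 0 -> bdominated (fun n => w ^ n * tsgn (q ^+ 12) n).
  move=> w0; have [M _ HM] := theta_term_dominated _ gcC _ Q1 Q0 _ w0.
  by exists M, `|q ^+ 12|; split=> //; apply: q01.
have w1 : - q ^ (-2) != 0 by rewrite oppr_eq0 expfz_neq0.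
have w2 : - q ^+ 4 != 0 by rewrite oppr_eq0 expf_neq0.
have -> : bailey_term = fun n => (q * ((- q ^ (-2)) ^ n * tsgn (q ^+ 12) n)
    + (- q ^+ 3) * ((- q ^+ 4) ^ n * tsgn (q ^+ 12) n))
    * ((1 - z * q ^ (3 * n + 1))^-1 * (1 - z^-1 * q ^ (3 * n + 1))^-1).
  apply/funext => n; rewrite /bailey_term /tsgn.
  have sgn (x : C) : x != 0 -> (- x) ^ n * (-1) ^ n = x ^ n.
    by move=> x0; rewrite -expfzMl mulrN1 opprK.
  rewrite !(mulrA ((- _) ^ n)) !sgn ?expfz_neq0 ?expf_neq0//.
  rewrite (exprnP q 12) (exprnP q 4) !exprz_exp.
  have e1 : q ^ (6 * n * n + n) * q ^ (3 * n + 1) = q * (q ^ (- 2 * n) * q ^ (12%N%:Z * tri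
    n)).
    rewrite [X in _ = X * _](esym (expr1z q)) -!expfzDr//; congr (_ ^ _).
    have -> : 12%N%:Z * tri n = 6 * (tri n * 2) by ring.
    by rewrite tri_double; ring.
  have e2 : q ^ (6 * n * n + n) * q ^ (3 * n + 1) * q ^ (6 * n + 2)
      = q ^+ 3 * (q ^ (4%N%:Z * n) * q ^ (12%N%:Z * tri n)).
    rewrite (exprnP q 3) -!expfzDr//; congr (_ ^ _).
    have -> : 12%N%:Z * tri n = 6 * (tri n * 2) by ring.
    by rewrite tri_double; ring.
  rewrite invfM; move: e1 e2.
  set X1 := q ^ _; set X2 := q ^ _; set X3 := q ^ (- 2 * n); set X4 := q ^ (_ * tri n).
  set X5 := q ^ (6 * n + 2); set X6 := q ^ (_ * n).
  set Y1 := (_)^-1; set Y2 := (_)^-1 => e1 e2.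
  transitivity ((X1 * X2 - X1 * X2 * X5) * (Y1 * Y2)); first by ring.
  by rewrite e2 e1; ring.
apply: (bdominatedM _ _ _ (B1 * B2)).
  by apply: bdominatedD; apply: bdominatedZ; apply: dom.
by move=> n; rewrite normrM; apply: ler_pM.
Qed.

(** Writing the tails as quotients, such as (z q^n)_oo = (z)_oo / (z)_n, gives the n-th term E / (Z
    Z') q^n (z)_n (1/z)_n beta_n. The window [N] of [bailey_pair] serves all n <= N at once, so the
    sums over n and i are exchanged while finite. *)
Lemma PPtilde_bailey : PPtilde z q = (qpoch q q)^-1 * bilateral_sum bailey_term.
Proof.
have qq k : q * q ^+ k != 1 by rewrite -exprS; apply: (qZ k.+1%:Z).
pose E := qpoch q q; have E0 : E != 0 by exact: qpoch_neq0.
pose Z := qpoch z q; have Z0 : Z != 0 by apply: qpoch_neq0 => // k; exact: (zq (Posz k)).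
pose Z' := qpoch z^-1 q; have Z'0 : Z' != 0 by apply: qpoch_neq0 => // k;
  exact: (zq' (Posz k)).
have zi0 : z^-1 != 0 by rewrite invr_neq0.
have finite N : (0 < N)%N ->
  \sum_(1 <= n < N.+1) q ^+ n * qpoch (q ^+ (2 * n)) q /
      (qpoch (z * q ^+ n) q * qpoch (z^-1 * q ^+ n) q) =
  E / (Z * Z') * (qp z q N.+1 * qp z^-1 q N.+1 *
   bsum N (fun i => bailey_term i * (iqp q (N%:Z - (3 * i + 1)) * iqp q (N%:Z + (3 * i +
     1))))).
  move=> N0.
  pose u n r := q ^+ n * qp z q n * qp z^-1 q n * (iqp q (n%:Z - r) * iqp q (n%:Z + r)).
  pose a i := q ^ (6 * i * i + i) * (1 - q ^ (6 * i + 2)).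
  transitivity (E / (Z * Z') * \sum_(1 <= n < N.+1) bsum N (fun i => a i * u n (3 * i + 1))).
    rewrite mulr_sumr big_nat [RHS]big_nat; apply: eq_bigr => -[//|n] /andP[_ nN].
    have -> : bsum N (fun i => a i * u n.+1 (3 * i + 1)) =
        q ^+ n.+1 * qp z q n.+1 * qp z^-1 q n.+1 * iqp q n.*2.+1.
      rewrite (bailey_pair _ _ q0 qZ N n)// /bsum mulr_sumr; apply: eq_bigr => k _.
      by rewrite /u -/(a _) -/(a _); ring.
    rewrite /E (qpoch_split _ gcC _ q1 q n.*2.+1) -exprS.
    have -> : n.*2.+2 = (2 * n.+1)%N by lia.
    have hz : qp z q n.+1 != 0 by apply: qp_neq0 => k; exact: (zq (Posz k)).
    have hz' : qp z^-1 q n.+1 != 0 by apply: qp_neq0 => k; exact: (zq' (Posz k)).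
    have hq : qp q q n.*2.+1 != 0 by exact: qqp_neq0.
    move: Z0 Z'0; rewrite /Z /Z' (qpoch_split _ gcC _ q1 z n.+1) (qpoch_split _ gcC _ q1
      z^-1 n.+1) iqp_nat.
    rewrite !mulf_eq0 !negb_or => /andP[_ h1] /andP[_ h2].
    move: hz hz' hq h1 h2.
    move: (qp z q n.+1) (qp z^-1 q n.+1) (qp q q n.*2.+1) (q ^+ n.+1) (qpoch _ q) (qpoch _
      q) (qpoch _ q).
    by move=> x1 x2 x3 x4 x5 x6 x7 x10 x20 x30 x60 x70; field; apply/and5P.
  congr (_ * _); rewrite /bsum exchange_big/= mulr_sumr; apply: eq_bigr => k _.
  rewrite big_split/= mulrDr -!mulr_sumr.
  (* The telescoping sum starts at n = 0; that term vanishes for r != 0, which holds for every r =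
     3i + 1. *)
  have sumu r : r != 0 -> z * q ^ r != 1 -> z^-1 * q ^ r != 1 ->
    \sum_(1 <= n < N.+1) u n r = qp z q N.+1 * qp z^-1 q N.+1 * (iqp q (N%:Z - r) * iqp q
      (N%:Z + r))
     * (q ^ r / ((1 - z * q ^ r) * (1 - z^-1 * q ^ r))).
    move=> r0 h1 h2; rewrite -bailey_telescope//= [RHS]big_ltn//.
    have -> : iqp q (0%N%:Z - r) * iqp q (0%N%:Z + r) = 0.
      rewrite sub0r add0r; have [rn|rn] : r < 0 \/ - r < 0 by lia.
        by rewrite (iqp_neg _ _ r rn) mulr0.
      by rewrite (iqp_neg _ _ _ rn) mul0r.
    by rewrite mulr0 add0r.
  have r0 (i : int) : 3 * i + 1 != 0 by lia.
  have comb (A K I Y : C) : A * (K * I * Y) = K * (A * Y * I) by ring.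
  by rewrite !sumu// (comb (a (Posz k))) (comb (a (Negz k))) -mulrDr.
have [B B0 HB] := qpV_bounded _ gcC _ q1 _ qq.
have iqp_bound n : `|iqp q n| <= B by case: n => n; [exact: HB | rewrite iqp_neg// normr0 ltW].
have iqp_cvg n : (fun N : nat => iqp q (N%:Z + n)) @ \oo --> E^-1.
  have := cvg_absz _ _ _ n (qpV_cvg _ gcC _ q1 _ qq).
  apply: cvg_trans; apply: near_eq_cvg; near=> N.
  have Nn : (absz n <= N)%N by near: N; exists (absz n).
  have -> : N%:Z + n = absz (N%:Z + n)%R by lia.
  by [].
have [M [r [r01 HM]]] := bailey_term_dominated.
pose T N i := bailey_term i * (iqp q (N%:Z - (3 * i + 1)) * iqp q (N%:Z + (3 * i + 1))).
have T_cvg : (fun N => bsum N (T N)) @ \oo --> bilateral_sum (fun i => bailey_term i *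
  (E^-1 * E^-1)).
  apply: (bsum_tannery _ gcC T _ (M * (B * B)) r r01) => [N n|n].
    rewrite /T normrM mulrAC; apply: ler_pM => //.
    by rewrite normrM; apply: ler_pM.
  apply: cvgM; first exact: cvg_cst.
  by apply: cvgM; apply: iqp_cvg.
have R_cvg : (fun N => E / (Z * Z') * (qp z q N.+1 * qp z^-1 q N.+1 * bsum N (T N))) @ \oo -->
    E / (Z * Z') * (Z * Z' * bilateral_sum (fun i => bailey_term i * (E^-1 * E^-1))).
  apply: cvgM; first exact: cvg_cst.
  apply: cvgM => //; apply: cvgM.
    by apply: (cvg_subseq _ (fun N => qp z q N) _ S) => //; exact: qp_cvg.
  by apply: (cvg_subseq _ (fun N => qp z^-1 q N) _ S) => //; exact: qp_cvg.
rewrite /PPtilde; apply: (cvg_lim (@norm_hausdorff _ C)).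
rewrite -cvg_shiftS /=.
have -> : E^-1 * bilateral_sum bailey_term =
   E / (Z * Z') * (Z * Z' * bilateral_sum (fun i => bailey_term i * (E^-1 * E^-1))).
  have -> : bilateral_sum (fun i => bailey_term i * (E^-1 * E^-1)) = (E^-1 * E^-1) *
    bilateral_sum bailey_term.
    rewrite -bilateral_sumZ//; last exact: bailey_term_dominated.
    by congr bilateral_sum; apply/funext => n; rewrite mulrC.
  by field; apply/and3P.
apply: cvg_trans R_cvg; apply: near_eq_cvg; near=> N.
rewrite -finite//.
by near: N; exists 1%N.
Unshelve. all: by end_near.
Qed.

End BaileyLimit.
Arguments bailey_term {C}.

(** * Theta functions modulo 9 *)

(** After substitution, u and v enter both sides only through - u/t2 and - v/t4 times t4 - r t2 -
    r^2 t1, so they cancel. The rest differs by an explicit multiple of the last hypothesis. *)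
Lemma trisection_algebra (F : fieldType) (t1 t2 t3 t4 e u v w d g h Q r : F) :
  t1 != 0 -> t2 != 0 -> t3 != 0 -> t4 != 0 -> e != 0 -> Q = r ^+ 3 ->
  w = e ^+ 2 * t3 * t4 / (t1 * t2 ^+ 2) - t4 / t2 * u ->
  d = t1 / t2 * u - e ^+ 2 * t3 / (t1 * t4) ->
  g = Q * e ^+ 2 * t3 / t4 ^+ 2 - t2 / t4 * v ->
  h = e ^+ 2 * t3 / (t1 * t4) - t1 / t4 * v ->
  t2 ^+ 2 * t4 - t1 * t4 ^+ 2 = Q * t1 ^+ 2 * t2 ->
  (w - v) + r * (u - g) + r ^+ 2 * (d - h) =
  e * (t4 - r * t2 - r ^+ 2 * t1) *
    (e * t3 / (t1 ^+ 2 * t4) - u / (e * t2) - v / (e * t4)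
     + r * (e * t3 / (t1 * t2 * t4))).
Proof.
move=> h1 h2 h3 h4 he -> -> -> -> -> /eqP rel; apply/eqP; rewrite -subr_eq0.
rewrite (_ : _ - _ = e ^+ 2 * t3 * (t4 - r * t2) / (t1 ^+ 2 * t2 ^+ 2 * t4 ^+ 2) *
    (r ^+ 3 * t1 ^+ 2 * t2 - (t2 ^+ 2 * t4 - t1 * t4 ^+ 2))).
  by move: rel; rewrite eq_sym -subr_eq0 => /eqP ->; rewrite mulr0.
by field; rewrite h1 h2 h4 he.
Qed.

Section ModuloNine.
Variable C : numFieldType.
Hypothesis gcC : geometrically_complete C.
Variable q : C.
Hypothesis q1 : `|q| < 1.
Hypothesis q0 : q != 0.

Let p1 : `|q ^+ 9| < 1. Proof. by rewrite normrX exprn_ilt1. Qed.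
Let p0 : q ^+ 9 != 0. Proof. by rewrite expf_neq0. Qed.

Definition theta9 (a : int) : C := qtheta (q ^ a) (q ^+ 9).
Local Notation T := theta9.
Local Notation L a b := (Sigmaz a b 9 q).
Local Notation E := (qpoch (q ^+ 9) (q ^+ 9)).

Lemma theta9_sym (a : int) : T (9 - a) = T a.
Proof.
rewrite /T -[RHS]qtheta_sym ?expfz_neq0//; congr qtheta.
by rewrite expfzDr// -invr_expz.
Qed.

Lemma theta9_opp (a : int) : T (- a) = - (q ^ a)^-1 * T a.
Proof. by rewrite /T -invr_expz qtheta_inv// expfz_neq0. Qed.

Lemma theta9_neq0 (a : int) : ~~ (9 %| a)%Z -> T a != 0.
Proof.
move=> a9; apply: qtheta_neq0 => //; first by rewrite expfz_neq0.
by move=> n; apply: exp9_neq1.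
Qed.

Lemma qpoch9_neq0 : E != 0.
Proof.
apply: qpoch_neq0 => // k; rewrite -exprS -exprM.
by apply: (expz_neq1 _ q q1 (9 * k.+1)%N%:Z).
Qed.

Let T1 := theta9_neq0 1 isT.
Let T2 := theta9_neq0 2 isT.
Let T3 := theta9_neq0 3 isT.
Let T4 := theta9_neq0 4 isT.
Let E0 := qpoch9_neq0.

(** Rewriting table: with the inversion rules below, every theta value in the five expansions
    becomes a monomial times [T 1], [T 2], [T 3] or [T 4]. *)
Let t5 : T 5 = T 4 := theta9_sym 4.
Let t6 : T 6 = T 3 := theta9_sym 3.
Let t7 : T 7 = T 2 := theta9_sym 2.
Let t8 : T 8 = T 1 := theta9_sym 1.
Let n1 : T (-1) = - q^-1 * T 1 := theta9_opp 1.
Let n2 : T (-2) = - q ^- 2 * T 2 := theta9_opp 2.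
Let n3 : T (-3) = - q ^- 3 * T 3 := theta9_opp 3.
Let n4 : T (-4) = - q ^- 4 * T 4 := theta9_opp 4.
Let n5 : T (-5) = - q ^- 5 * T 4.
Proof. by rewrite -t5; exact: (theta9_opp 5). Qed.
Let n6 : T (-6) = - q ^- 6 * T 3.
Proof. by rewrite -t6; exact: (theta9_opp 6). Qed.
Let n7 : T (-7) = - q ^- 7 * T 2.
Proof. by rewrite -t7; exact: (theta9_opp 7). Qed.
Let tE := (t5, t6, t7, t8, (n1, n2, n3, n4, n5, n6, n7)).

Let flip := Sigmaz_flip _ gcC q q1 q0.
Let f1 : L 8 14 = - q ^- 13 * L 1 (-5) := flip 8 14 isT.
Let f2 : L 2 (-10) = - q ^+ 17 * L 7 19 := flip 2 (-10) isT.
Let f3 : L 5 2 = - q ^+ 2 * L 4 7 := flip 5 2 isT.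
Let f4 : L 2 (-4) = - q ^+ 11 * L 7 13 := flip 2 (-4) isT.
Let f5 : L 5 8 = - q ^- 4 * L 4 1 := flip 5 8 isT.
Let f6 : L 8 17 = - q ^- 16 * L 1 (-8) := flip 8 17 isT.
Let f7 : L 2 (-7) = - q ^+ 14 * L 7 16 := flip 2 (-7) isT.

Let pf := Sigmaz_partial_fractions _ gcC q q1 q0.

(** [U] and [V] are the combinations displayed in [A0]; [W] and [D] play the same part for the
    residue pairs 2, 7 and 4, 5, and are to be eliminated. *)
Let U := L 1 (-14) + q * L 1 (-5).
Let V := q * L 1 (-8) + q ^+ 5 * L 4 1.
Let W := q ^+ 11 * L 7 10 + q ^+ 18 * L 7 19.
Let D := q ^+ 3 * L 4 (-2) + q ^+ 7 * L 4 7.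

(** Derives an equation as an explicit multiple [c] of a known one, leaving a rational identity for
    [field]. *)
Let eliminate (c l r x y : C) : l = r -> x - y = c * (r - l) -> x = y.
Proof. by move=> -> /eqP; rewrite subrr mulr0 subr_eq0 => /eqP. Qed.

(** After flipping, the series at 1 and 8 merge into [U] and those at 2 and 7 into [W]. In the next
    two lemmas 4 and 5 merge into [D] in the same way. *)
Lemma lambert_UW : T 4 / T 2 * U + W = E ^+ 2 * T 3 * T 4 / (T 1 * T 2 ^+ 2).
Proof.
have h : E ^+ 2 / (T 1 * T 8 * T 2 * T 7) =
    L 1 (-14) / (T 7 * T 1 * T 6) + L 8 14 / (T (-7) * T (-6) * T (-1))
  + L 2 (-10) / (T (-1) * T 6 * T 5) + L 7 10 / (T (-6) * T 1 * T (-5))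
  := pf 1 8 2 7 18 erefl isT.
rewrite !tE f1 f2 in h.
apply: (eliminate (T 1 * T 3 * T 4) _ _ _ _ h); rewrite /U /W.
by field; rewrite q0 T1 T2 T3 T4.
Qed.

Lemma lambert_UD : T 1 / T 2 * U - D = E ^+ 2 * T 3 / (T 1 * T 4).
Proof.
have h : E ^+ 2 / (T 1 * T 8 * T 4 * T 5) =
    L 1 (-14) / (T 7 * T 3 * T 4) + L 8 14 / (T (-7) * T (-4) * T (-3))
  + L 4 (-2) / (T (-3) * T 4 * T 1) + L 5 2 / (T (-4) * T 3 * T (-1))
  := pf 1 8 4 5 18 erefl isT.
rewrite !tE f1 f3 in h.
apply: (eliminate (T 1 * T 3 * T 4) _ _ _ _ h); rewrite /U /D.
by field; rewrite q0 T1 T2 T3 T4.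
Qed.

Lemma lambert_WD : W / T 4 + D / T 1 = - q * E ^+ 2 * T 3 / (T 2 * T 4 ^+ 2).
Proof.
have h : E ^+ 2 / (T 2 * T 7 * T 4 * T 5) =
    L 2 (-10) / (T 5 * T 2 * T 3) + L 7 10 / (T (-5) * T (-3) * T (-2))
  + L 4 (-2) / (T (-2) * T 3 * T 1) + L 5 2 / (T (-3) * T 2 * T (-1))
  := pf 2 7 4 5 18 erefl isT.
rewrite !tE f2 f3 in h.
apply: (eliminate (- q * T 2 * T 3) _ _ _ _ h); rewrite /W /D.
by field; rewrite q0 T1 T2 T3 T4.
Qed.

(** Here the series at 1 and the flipped one at 5 form [V], while those at 4 and 2 stay separate. *)
Lemma lambert_V1 :
  q ^+ 6 * L 4 4 + q ^+ 13 * L 7 13 + T 2 / T 4 * V = q * E ^+ 2 * T 3 / T 4 ^+ 2.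
Proof.
have h : E ^+ 2 / (T 1 * T 2 * T 4 * T 5) =
    L 1 (-8) / (T 1 * T 3 * T 4) + L 2 (-4) / (T (-1) * T 2 * T 3)
  + L 4 4 / (T (-3) * T (-2) * T 1) + L 5 8 / (T (-4) * T (-3) * T (-1))
  := pf 1 2 4 5 12 erefl isT.
rewrite !tE f4 f5 in h.
apply: (eliminate (q * T 1 * T 2 * T 3) _ _ _ _ h); rewrite /V.
by field; rewrite q0 T1 T2 T3 T4.
Qed.

Lemma lambert_V2 :
  L 1 (-11) + q ^+ 15 * L 7 16 + T 1 / T 4 * V = E ^+ 2 * T 3 / (T 1 * T 4).
Proof.
have h : E ^+ 2 / (T 1 * T 8 * T 2 * T 4) =
    L 1 (-11) / (T 7 * T 1 * T 3) + L 8 17 / (T (-7) * T (-6) * T (-4))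
  + L 2 (-7) / (T (-1) * T 6 * T 2) + L 4 1 / (T (-3) * T 4 * T (-2))
  := pf 1 8 2 4 15 erefl isT.
rewrite !tE f6 f7 in h.
apply: (eliminate (T 1 * T 2 * T 3) _ _ _ _ h); rewrite /V.
by field; rewrite q0 T1 T2 T3 T4.
Qed.

(* The three identities in [U], [W] and [D] are linearly dependent, which
   leaves a relation between theta functions alone. *)
Lemma theta9_relation :
  T 2 ^+ 2 * T 4 - T 1 * T 4 ^+ 2 = q * T 1 ^+ 2 * T 2.
Proof.
have hW : W = E ^+ 2 * T 3 * T 4 / (T 1 * T 2 ^+ 2) - T 4 / T 2 * U.
  by rewrite -lambert_UW addrC addKr.
have hD : D = T 1 / T 2 * U - E ^+ 2 * T 3 / (T 1 * T 4).
  by rewrite -lambert_UD opprB addrC subrK.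
(* The unknown [U] drops out: [W / T 4] contributes [- U / T 2] and [D / T 1] contributes
   [U / T 2]. *)
have h := lambert_WD; rewrite hW hD in h.
apply: (eliminate (T 1 ^+ 2 * T 2 ^+ 2 * T 4 ^+ 2 / (E ^+ 2 * T 3)) _ _ _ _ h).
by field; rewrite T1 T2 T3 T4 E0.
Qed.

(* The left-hand side is the trisection of the Bailey sum at a cube root of
   unity, [r] standing for the cube root of [q]. *)
Lemma lambert_trisection (r : C) : q = r ^+ 3 ->
  (W - V) + r * (U - (q ^+ 6 * L 4 4 + q ^+ 13 * L 7 13))
    + r ^+ 2 * (D - (L 1 (-11) + q ^+ 15 * L 7 16)) =
  E * (T 4 - r * T 2 - r ^+ 2 * T 1) *
    (E * T 3 / (T 1 ^+ 2 * T 4) - U / (E * T 2) - V / (E * T 4)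
     + r * (E * T 3 / (T 1 * T 2 * T 4))).
Proof.
move=> qr; apply: (trisection_algebra _ _ _ _ _ _ _ _ _ _ _ _ q) => //.
- by rewrite -lambert_UW addrC addKr.
- by rewrite -lambert_UD opprB addrC subrK.
- by rewrite -lambert_V1 addrK.
- by rewrite -lambert_V2 addrK.
- exact: theta9_relation.
Qed.

End ModuloNine.
Arguments theta9 {C}.

(** * Trisection of the Bailey sum *)

(** Splitting modulo 3 passes from base q^3 to base q^9; the denominator gives exponents 1, 4 and 7,
    and 7 = 9 - 2. *)
Lemma A1_theta9 (C : numFieldType) (q : C) : geometrically_complete C ->
  `|q| < 1 -> q != 0 ->
  A1 q = qpoch (q ^+ 9) (q ^+ 9) * theta9 q 3 / (theta9 q 1 * theta9 q 2 * theta9 q 4).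
Proof.
move=> gcC q1 q0.
have q31 : `|q ^+ 3| < 1 by rewrite normrX exprn_ilt1.
have q30 : q ^+ 3 != 0 by rewrite expf_neq0.
have e9 : (q ^+ 3) ^+ 3 = q ^+ 9 by rewrite -exprM.
rewrite /A1; congr (_ / _).
  rewrite (qpoch_trisect _ gcC _ q31 q30) e9 /theta9 /qtheta -[q ^ 3]/(q ^+ 3).
  have -> : q ^+ 9 / q ^+ 3 = q ^+ 3 * q ^+ 3 by field.
  have -> : q ^+ 3 * (q ^+ 3) ^+ 2 = q ^+ 9 by ring.
  ring.
rewrite (qtheta_trisect _ gcC _ q31 q30)// e9 -(theta9_sym _ q q0 2) /theta9 expr1z.
rewrite -[q ^ 4]/(q ^+ 4) -[q ^ (9 - 2)]/(q ^+ 7).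
have -> : q * q ^+ 3 = q ^+ 4 by ring.
have -> : q * (q ^+ 3) ^+ 2 = q ^+ 7 by ring.
ring.
Qed.

Section CubeRoot.
Variable C : numFieldType.
Hypothesis gcC : geometrically_complete C.
Variables q z : C.
Hypothesis q1 : `|q| < 1.
Hypothesis q0 : q != 0.
Hypothesis z3 : z ^+ 2 + z + 1 = 0.

Local Notation Q := (q ^+ 3).
Let Q1 : `|Q| < 1. Proof. by rewrite normrX exprn_ilt1. Qed.
Let Q0 : Q != 0. Proof. by rewrite expf_neq0. Qed.

Let zcube : z ^+ 3 = 1.
Proof.
apply/eqP; rewrite -subr_eq0.
by have -> : z ^+ 3 - 1 = (z - 1) * (z ^+ 2 + z + 1) by [ring]; rewrite z3 mulr0.
Qed.

Let z0 : z != 0.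
Proof. by apply: contra_eqN zcube => /eqP ->; rewrite expr0n eq_sym oner_neq0. Qed.

Let z_inv : z^-1 = - 1 - z.
Proof.
apply: (mulfI z0); rewrite mulfV//; apply/eqP; rewrite -subr_eq0.
by have -> : 1 - z * (-1 - z) = z ^+ 2 + z + 1 by [ring]; rewrite z3.
Qed.

Let zq (n : int) : z * q ^ n != 1.
Proof.
apply/negP => /eqP h.
have : (z * q ^ n) ^+ 3 = 1 by rewrite h expr1n.
rewrite exprMn zcube mul1r [LHS]exprnP exprz_exp => /eqP qn.
have n0 : n = 0.
  by apply/eqP; apply: contraTT qn => n0; apply: expz_neq1 => //; lia.
move: h; rewrite n0 expr0z mulr1 => z1.
have : (3%:R : C) = 0 by rewrite -z3 z1; ring.
by apply/eqP; rewrite pnatr_eq0.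
Qed.

Let lambert_term (a b n : int) : C :=
  (Q ^+ 9) ^ (2 * n * (n + 1)) * (Q ^ b) ^ n / (1 - Q ^ a * (Q ^+ 9) ^ n).

(** With X = q^(3i+1), z + 1/z = -1 turns the denominator into 1 + X + X^2, so (1 - X^2) / (1 + X +
    X^2) = (1 - X - X^2 + X^3) / (1 - X^3): four series. For i = 3n + j, X^3 = Q^a Q^(9n), and each
    further X raises b by 3. The -14 is 4 - 18, once 18 n (n + 1) is split off. *)
Lemma bailey_term_cube_root (j : nat) (n : int) : (j < 3)%N ->
  let a := (3 * j + 1)%N in let b : int := 12 * j%:Z - 14 in
  bailey_term q z (3 * n + j%:Z) =
    q ^+ (6 * j * j + 4 * j + 1) * (lambert_term a b n)
    + (- q ^+ (6 * j * j + 4 * j + 1 + a)) * lambert_term a (b + 3) n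
    + (- q ^+ (6 * j * j + 4 * j + 1 + a * 2)) * lambert_term a (b + 6) n
    + q ^+ (6 * j * j + 4 * j + 1 + a * 3) * lambert_term a (b + 9) n.
Proof.
move=> j3 a b; set c := (6 * j * j + 4 * j + 1)%N.
have a9 : ~~ (9 %| a%:Z)%Z by rewrite /a; case: j j3 {a b c} => [|[|[|]]].
have den := exp9_neq1 _ _ Q1 Q0 _ n a9.
rewrite /bailey_term /lambert_term; set i := 3 * n + j%:Z.
set X := q ^ (3 * i + 1).
have X3 : Q ^ a%:Z * (Q ^+ 9) ^ n = X ^+ 3.
  rewrite /X /i /a -exprM !exprnP !exprz_exp -expfzDr//; congr (_ ^ _); lia.
have X2 : q ^ (6 * i + 2) = X ^+ 2.
  by rewrite /X [RHS]exprnP exprz_exp; congr (_ ^ _); ring.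
have K0 : q ^ (6 * i * i + i) * X = q ^+ c * (Q ^+ 9) ^ (2 * n * (n + 1)) * (Q ^ b) ^ n.
  rewrite /X -exprM !exprnP !exprz_exp -!expfzDr//; congr (_ ^ _).
  have -> : c%:Z = 6 * j%:Z * j%:Z + 4 * j%:Z + 1 by rewrite /c; lia.
  by rewrite /i /b; ring.
have Kstep (d : int) : q ^+ a * (Q ^ (d + 3)) ^ n = (Q ^ d) ^ n * X.
  rewrite /X !exprnP !exprz_exp -!expfzDr//; congr (_ ^ _).
  by have -> : a%:Z = 3 * j%:Z + 1 by [rewrite /a; lia]; rewrite /i; ring.
have denX : (1 - z * X) * (1 - z^-1 * X) = 1 + X + X ^+ 2.
  rewrite z_inv; transitivity (1 + X + X ^+ 2 - X ^+ 2 * (z ^+ 2 + z + 1)); first by ring.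
  by rewrite z3 mulr0 subr0.
rewrite X3 in den; rewrite X2 X3 denX.
have den' : 1 + X + X ^+ 2 != 0.
  apply: contra den => /eqP h; rewrite -subr_eq0.
  by have -> : X ^+ 3 - 1 = (X - 1) * (1 + X + X ^+ 2) by [ring]; rewrite h mulr0.
have -> : b + 9 = b + 6 + 3 by ring.
have -> : b + 6 = b + 3 + 3 by ring.
have k1 := Kstep b; have k2 := Kstep (b + 3); have k3 := Kstep (b + 3 + 3).
rewrite (exprD q c a) (exprD q c (a * 2)) (exprD q c (a * 3)) (exprM q a 2) (exprM q a 3).
move: K0 k1 k2 k3 den.
move: (q ^ (6 * i * i + i)) (q ^+ c) ((Q ^+ 9) ^ (2 * n * (n + 1))) (q ^+ a) => K G P A.
move: ((Q ^ b) ^ n) ((Q ^ (b + 3)) ^ n) ((Q ^ (b + 3 + 3)) ^ n) ((Q ^ (b + 3 + 3 + 3)) ^ n).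
move=> B0 B1 B2 B3 K0 k1 k2 k3 den.
have -> : K * (1 - X ^+ 2) * (X / (1 + X + X ^+ 2)) = (K * X) * (1 - X ^+ 2) / (1 + X + X
  ^+ 2) by ring.
rewrite K0.
transitivity ((G * P * B0 - G * P * (A * B1) - G * P * (A * (A * B2)) + G * P * (A * (A *
  (A * B3)))) / (1 - X ^+ 3)); last by ring.
rewrite k3 [A * (B2 * X)]mulrA k2 [A * (B1 * X * X)]mulrA [A * (B1 * X)]mulrA k1.
have den1 : 1 - X ^+ 3 != 0 by rewrite subr_eq0 eq_sym.
by field; rewrite den1 den'.
Qed.

Lemma bilateral_sum_lin4 (f1 f2 f3 f4 : int -> C) (c1 c2 c3 c4 : C) :
  bdominated f1 -> bdominated f2 -> bdominated f3 -> bdominated f4 ->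
  bilateral_sum (fun n => c1 * f1 n + c2 * f2 n + c3 * f3 n + c4 * f4 n) =
  c1 * bilateral_sum f1 + c2 * bilateral_sum f2 + c3 * bilateral_sum f3 + c4 *
    bilateral_sum f4.
Proof.
move=> e1 e2 e3 e4; rewrite -!(bilateral_sumZ _ gcC)//; move: e1 e2 e3 e4.
move=> /(bdominatedZ _ _ c1) d1 /(bdominatedZ _ _ c2) d2.
move=> /(bdominatedZ _ _ c3) d3 /(bdominatedZ _ _ c4) d4.
have d12 := bdominatedD _ _ _ d1 d2; have d123 := bdominatedD _ _ _ d12 d3.
rewrite (bilateral_sumD _ gcC _ _ d123 d4) (bilateral_sumD _ gcC _ _ d12 d3).
by rewrite (bilateral_sumD _ gcC _ _ d1 d2).
Qed.

Lemma bailey_sum_cube_root (j : nat) : (j < 3)%N ->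
  let a := (3 * j + 1)%N in let b : int := 12 * j%:Z - 14 in
  bilateral_sum (fun n => bailey_term q z (3 * n + j%:Z)) =
    q ^+ (6 * j * j + 4 * j + 1) * Sigmaz a b 9 Q
    + (- q ^+ (6 * j * j + 4 * j + 1 + a)) * Sigmaz a (b + 3) 9 Q
    + (- q ^+ (6 * j * j + 4 * j + 1 + a * 2)) * Sigmaz a (b + 6) 9 Q
    + q ^+ (6 * j * j + 4 * j + 1 + a * 3) * Sigmaz a (b + 9) 9 Q.
Proof.
move=> j3 a b.
have a9 : ~~ (9 %| a%:Z)%Z by rewrite /a; case: j j3 {a b} => [|[|[|]]].
have /funext -> := fun n => bailey_term_cube_root j n j3.
by rewrite bilateral_sum_lin4//; exact: Sigmaz_dominated.
Qed.

Lemma PPtilde_cube_root : PPtilde z q = A0 Q + q * A1 Q + q ^+ 2 * A2 Q.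
Proof.
have t1 : theta9 Q 1 = qtheta Q (Q ^+ 9) by rewrite /theta9 expr1z.
have q9 : Q ^+ 9 = q ^+ 27 by rewrite -exprM.
have qq0 : qpoch q q != 0.
  by apply: qpoch_neq0 => // k; rewrite -exprS; apply: (expz_neq1 _ q q1 k.+1%:Z).
have eul : qpoch q q = qpoch (Q ^+ 9) (Q ^+ 9) *
    (theta9 Q 4 - q * theta9 Q 2 - q ^+ 2 * theta9 Q 1).
  rewrite t1 /theta9 -[Q ^ 4]/(Q ^+ 4) -[Q ^ 2]/(Q ^+ 2) q9 -!exprM.
  exact: euler_trisection.
rewrite (PPtilde_bailey _ gcC _ _ q1 q0 z0 zq).
rewrite (bilateral_sum_trisect _ gcC _ (bailey_term_dominated _ gcC _ _ q1 q0 z0 zq)).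
have B0 : bilateral_sum (fun n => bailey_term q z (3 * n + 0%N%:Z)) =
  q ^+ 1 * Sigmaz 1 (-14) 9 Q + (- q ^+ 2) * Sigmaz 1 (-11) 9 Q
  + (- q ^+ 3) * Sigmaz 1 (-8) 9 Q + q ^+ 4 * Sigmaz 1 (-5) 9 Q
  := bailey_sum_cube_root 0 isT.
have B1 : bilateral_sum (fun n => bailey_term q z (3 * n + 1)) =
  q ^+ 11 * Sigmaz 4 (-2) 9 Q + (- q ^+ 15) * Sigmaz 4 1 9 Q
  + (- q ^+ 19) * Sigmaz 4 4 9 Q + q ^+ 23 * Sigmaz 4 7 9 Q
  := bailey_sum_cube_root 1 isT.
have B2 : bilateral_sum (fun n => bailey_term q z (3 * n + 2)) =
  q ^+ 33 * Sigmaz 7 10 9 Q + (- q ^+ 40) * Sigmaz 7 13 9 Q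
  + (- q ^+ 47) * Sigmaz 7 16 9 Q + q ^+ 54 * Sigmaz 7 19 9 Q
  := bailey_sum_cube_root 2 isT.
have -> : bilateral_sum (fun n => bailey_term q z (3 * n)) =
    bilateral_sum (fun n => bailey_term q z (3 * n + 0%N%:Z)).
  by congr bilateral_sum; apply/funext => n; rewrite addr0.
rewrite B0 B1 B2; apply: (mulfI qq0); rewrite mulVKf//.
(* In base Q the cube root [r] is [q] itself. The twelve exponents of q sort modulo 3: 3, 15, 33, 54
   give W - V, the class of 1 the terms with [r], the class of 2 those with [r ^+ 2]. *)
have := lambert_trisection _ gcC Q Q1 Q0 q erefl; rewrite -eul => tri.
have A0E : A0 Q + q * A1 Q + q ^+ 2 * A2 Q =
  qpoch (Q ^+ 9) (Q ^+ 9) * theta9 Q 3 / (theta9 Q 1 ^+ 2 * theta9 Q 4)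
  - (Sigmaz 1 (-14) 9 Q + Q * Sigmaz 1 (-5) 9 Q) / (qpoch (Q ^+ 9) (Q ^+ 9) * theta9 Q 2)
  - (Q * Sigmaz 1 (-8) 9 Q + Q ^+ 5 * Sigmaz 4 1 9 Q) / (qpoch (Q ^+ 9) (Q ^+ 9) * theta9 Q 4)
  + q * (qpoch (Q ^+ 9) (Q ^+ 9) * theta9 Q 3 / (theta9 Q 1 * theta9 Q 2 * theta9 Q 4)).
  rewrite /A2 mulr0 addr0 (A1_theta9 _ _ gcC Q1 Q0) /A0 -t1.
  rewrite -[qtheta (Q ^+ 2) _]/(theta9 Q 2) -[qtheta (Q ^+ 3) _]/(theta9 Q 3).
  rewrite -[qtheta (Q ^+ 4) _]/(theta9 Q 4).
  congr (_ + _); rewrite !mul1r; congr (_ - _ - _); exact: mulrC.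
rewrite A0E -tri.
ring.
Qed.

End CubeRoot.

Theorem theorem1p2 (R : realType) (q zeta3 : R[i])
    (hq : 0 < `|q| < 1) (hzeta3 : 3.-primitive_root zeta3) :
  PPtilde zeta3 q = A0 (q ^+ 3) + q * A1 (q ^+ 3) + q ^+ 2 * A2 (q ^+ 3).
Proof.
have /andP[q_gt0 q1] := hq.
apply: (PPtilde_cube_root _ (complex_geometrically_complete R)) => //.
  by rewrite -normr_gt0.
have z3 := prim_expr_order hzeta3.
have z1 : zeta3 - 1 != 0.
  apply/negP => /eqP/subr0_eq z1.
  by have := prim_order_dvd hzeta3 1; rewrite z1 expr1n eqxx.
apply: (mulfI z1); rewrite mulr0.
have -> : (zeta3 - 1) * (zeta3 ^+ 2 + zeta3 + 1) = zeta3 ^+ 3 - 1 by ring.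
by rewrite z3 subrr.
Qed.
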